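(* Let $d\ge 1$ and $k\geq 1$ be integers, let $\mathcal{P}_n$ be a homogeneous Poisson point process of rate $n$ on the flat torus $\mathbb{T}^d$, let $r=r(n)>0$ with $r(n)\to 0$ as $n\to\infty$, and let $\Lambda=n\omega_d r^d$. Let $\mathcal{C}_r^{(k)}$ be the event that every point of $\mathbb{T}^d$ is at distance less than $r$ from at least $k$ points of $\mathcal{P}_n$. Suppose that $w(n)\rightarrow\infty$ as $n\rightarrow\infty$. Then $$\lim_{n\rightarrow\infty}\mathbb{P}(\mathcal{C}_{r}^{(k)})=\begin{cases}1 & \text{if } \Lambda = \log n + (d+k-2)\log\log n + w(n), \\ 0 & \text{if } \Lambda = \log n + (d+k-2)\log\log n - w(n).\end{cases}$$
   Context: $\mathbb{T}^d=\mathbb{R}^d/\mathbb{Z}^d$ is the flat torus with metric $d_{\mathbb{T}}(x,y)=\min_{\delta\in\mathbb{Z}^d}\|x-y+\delta\|$ and unit volume. $\omega_d$ is the volume of the unit ball in $\mathbb{R}^d$. $B_r(x)$ is the open ball of radius $r$ about $x$. The $k$-coverage process is $B_r^{(k)}=B_r^{(k)}(\mathcal{P}_n)=\{x\in\mathbb{T}^d: |B_r(x)\cap\mathcal{P}_n|\ge k\}$, and $\mathcal{C}_r^{(k)}=\{\mathbb{T}^d\subset B_r^{(k)}\}$. The function $w$ is such that the stated $\Lambda$ is positive and corresponds to a sequence $r(n)\to0$. *)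

(* Defs.v *)
From HB Require Import structures.
From mathcomp Require Import all_boot all_order all_algebra.
From mathcomp Require Import all_classical all_reals all_analysis.
From mathcomp Require Import measurable_realfun.

Set Implicit Arguments.
Unset Strict Implicit.
Unset Printing Implicit Defensive.

Import Order.TTheory GRing.Theory Num.Theory.
Import numFieldNormedType.Exports.

Local Open Scope classical_set_scope.
Local Open Scope ring_scope.

(* R^d as tuples, because these carry the product (= Borel) sigma-algebra in
   the library, whereas row vectors have no measurable structure and their
   norm is the sup norm. *)
Definition Rvec (R : realType) (d : nat) := d.-tuple (measurableTypeR R).

Definition vcoord (R : realType) (d : nat) (x : Rvec R d) (i : 'I_d) : R :=
  tnth x i.

Definition enorm (R : realType) (d : nat) (x : 'I_d -> R) : R :=
  Num.sqrt (\sum_i x i ^+ 2).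

(* d-dimensional Lebesgue measure: the d-fold product of lebesgue_measure,
   transported along R x R^d -> R^d.+1; R^0 is a point of mass 1. *)
Fixpoint lebesgue_vec (R : realType) (d : nat) : set (Rvec R d) -> \bar R :=
  match d return set (Rvec R d) -> \bar R with
  | 0 => \d_([tuple] : Rvec R 0)
  | d'.+1 => pushforward (lebesgue_measure \x @lebesgue_vec R d')%E
      (fun p => [the d'.+1.-tuple (measurableTypeR R) of p.1 :: p.2])
  end.

Definition unit_ball_volume (R : realType) (d : nat) : R :=
  fine (lebesgue_vec [set x : Rvec R d | enorm (vcoord x) < 1]).

Section torus.
Variables (R : realType) (d : nat).

Definition Zd_rel (x y : Rvec R d) : bool :=
  [forall i, vcoord x i - vcoord y i \is a Num.int].

Lemma Zd_rel_refl : reflexive Zd_rel.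
Proof. by move=> x; apply/forallP => i; rewrite subrr rpred0. Qed.

Lemma Zd_rel_sym : symmetric Zd_rel.
Proof.
suff H x y : Zd_rel x y -> Zd_rel y x by move=> x y; apply/idP/idP; exact: H.
by move=> /forallP xy; apply/forallP => i; rewrite -opprB rpredN.
Qed.

Lemma Zd_rel_trans : transitive Zd_rel.
Proof.
move=> y x z /forallP xy /forallP yz; apply/forallP => i.
by rewrite -(subrKA (vcoord y i)) rpredD.
Qed.

Canonical Zd_equiv : equiv_rel (Rvec R d) :=
  EquivRel Zd_rel Zd_rel_refl Zd_rel_sym Zd_rel_trans.

Definition torus := {eq_quot Zd_equiv}%qT.

HB.instance Definition _ := Choice.on torus.
HB.instance Definition _ := EqQuotient.on torus.

Definition tproj (x : Rvec R d) : torus := (\pi_torus x)%qT.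

HB.instance Definition _ := isPointed.Build torus (tproj (nseq_tuple d 0)).

(* A set of the torus is Borel iff its Z^d-periodic lift to R^d is Borel. *)
Definition torus_measurable : set (set torus) :=
  [set A | measurable (tproj @^-1` A)].

Let torus_measurable0 : torus_measurable set0.
Proof. by rewrite /torus_measurable /= preimage_set0. Qed.

Let torus_measurableC A : torus_measurable A -> torus_measurable (~` A).
Proof. by rewrite /torus_measurable /= preimage_setC; exact: measurableC. Qed.

Let torus_measurable_bigcup (F : (set torus)^nat) :
  (forall i, torus_measurable (F i)) -> torus_measurable (\bigcup_i F i).
Proof.
move=> mF; rewrite /torus_measurable /= preimage_bigcup.
by apply: bigcup_measurable => i _; exact: mF.
Qed.

HB.instance Definition _ := @isMeasurable.Build default_measure_display torus
  torus_measurable torus_measurable0 torus_measurableC torus_measurable_bigcup.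

(* The volume of A, computed in the fundamental domain [0, 1[^d. *)
Definition torus_volume (A : set torus) : \bar R :=
  lebesgue_vec ([set x : Rvec R d | forall i, 0 <= vcoord x i < 1] `&`
                tproj @^-1` A).

(* The infimum is attained and does not depend on the representatives. *)
Definition torus_dist (x y : torus) : R :=
  inf [set enorm (fun i => vcoord (repr x) i - vcoord (repr y) i + (delta i)%:~R)
      | delta in [set: 'I_d -> int]].

Definition torus_ball (r : R) (x : torus) : set torus :=
  [set y | torus_dist x y < r].

Definition k_covered (k : nat) (r : R) (X : set torus) : set torus :=
  [set x | (k%:R%:E <= counting (torus_ball r x `&` X) :> \bar R)%E].

End torus.

(* The library's poisson_pmf is constantly 1 at rate 0, a rate that occurs
   here for null sets. *)
Definition pois_pmf (R : realType) (rate : R) (j : nat) : R :=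
  expR (- rate) * rate ^+ j / j`!%:R.

Section processes.
Context (R : realType) (disp : measure_display) (Omega : measurableType disp).
Variable P : probability Omega R.

Definition mutually_independent (m : nat) (X : 'I_m -> Omega -> \bar R) :=
  forall B : 'I_m -> set (\bar R), (forall i, measurable (B i)) ->
    P (\bigcap_(i in [set: 'I_m]) X i @^-1` B i) =
    (\prod_(i < m) P (X i @^-1` B i))%E.

Definition point_count (d : nat) (X : Omega -> set (torus R d))
    (A : set (torus R d)) (omega : Omega) : \bar R :=
  counting (A `&` X omega).

(* A random countable set X is a homogeneous Poisson process of rate lambda. *)
Record poisson_process (d : nat) (lambda : R)
    (X : Omega -> set (torus R d)) : Prop := PoissonProcess {
  poisson_countable : forall omega, countable (X omega) ;
  poisson_measurable : forall A, measurable A ->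
    measurable_fun [set: Omega] (point_count X A) ;
  poisson_law : forall A, measurable A -> forall j : nat,
    P [set omega | point_count X A omega = j%:R%:E] =
    (pois_pmf (lambda * fine (torus_volume A)) j)%:E ;
  poisson_independent : forall (m : nat) (A : 'I_m -> set (torus R d)),
    (forall i, measurable (A i)) -> trivIset [set: 'I_m] A ->
    mutually_independent (fun i => point_count X (A i)) }.

Definition coverage_event (d k : nat) (r : R) (X : Omega -> set (torus R d)) :
    set Omega :=
  [set omega | [set: torus R d] `<=` k_covered k r (X omega)].

End processes.

(* Main.v *)
(* Let Phi = n L^(d+k-2) e^(-L), where L = Lambda is the mean number of points in a
   ball of radius r.  When w is at most of order log n, Phi is e^(-w) in the first regime
   and e^w in the second, up to constants, and both regimes reduce to finite grids of mesh of order r / L, the scale of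
   the components of the uncovered region.

   If some x is not k-covered, then a grid point within r / L of x has fewer than k
   points in its ball of radius r (1 - 1/L), whose mean count is at least L - d.  The
   union bound over O((L / r)^d) = O(n L^(d-1)) grid points, each failing with
   probability O(L^(k-1) e^(-L)), gives P(not covered) = O(Phi).

   Conversely, apply the second moment method to the number Z of grid points whose ball
   of radius r has fewer than k points.  If two of them fail, then the first ball and
   the difference of the second with the first, which are independent, have fewer than
   k points each; the volume of the difference is at least of order r^(d-1) times the
   distance of the centres (until the balls are disjoint), so the covariances are
   summable geometrically over the grid and Var Z = O(E Z).  Hence
   P(covered) <= P(Z = 0) = O(1 / E Z) = O(1 / Phi). *)
Require Import Defs.
From HB Require Import structures.
From mathcomp Require Import all_boot all_order all_algebra.
From mathcomp Require Import all_classical all_reals all_analysis.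
From mathcomp Require Import measurable_realfun zify ring lra.

Set Implicit Arguments.
Unset Strict Implicit.
Unset Printing Implicit Defensive.

Import Order.TTheory GRing.Theory Num.Theory.
Import numFieldNormedType.Exports.

Local Open Scope classical_set_scope.
Local Open Scope ring_scope.

(** * Lebesgue measure on R^d *)

Definition vec_of (R : realType) (d : nat) (f : 'I_d -> R) : Rvec R d :=
  [tuple f i | i < d].

Lemma vcoord_vec_of (R : realType) (d : nat) (f : 'I_d -> R) i :
  vcoord (vec_of f) i = f i.
Proof. by rewrite /vcoord tnth_mktuple. Qed.

Lemma measurable_vcoord (R : realType) (d : nat) (i : 'I_d) :
  measurable_fun [set: Rvec R d] (fun x => vcoord x i).
Proof. exact: measurable_tnth. Qed.

Lemma measurable_vec_of (R : realType) (d : nat) disp (T : measurableType disp)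
    (f : 'I_d -> T -> R) :
  (forall i, measurable_fun [set: T] (f i)) ->
  measurable_fun [set: T] (fun t => vec_of (f^~ t)).
Proof.
move=> mf; apply/measurable_fun_tnthP => i.
rewrite (_ : _ \o _ = f i); first exact: mf.
by apply/funext => t /=; rewrite tnth_mktuple.
Qed.

Section vec_cons.
Context (R : realType) (d : nat).

(** The map of the pushforward in [lebesgue_vec], named so that [lebesgue_vecS] holds by
    conversion. *)
Definition vec_cons (p : measurableTypeR R * Rvec R d) : Rvec R d.+1 :=
  [the d.+1.-tuple (measurableTypeR R) of p.1 :: p.2].

Definition vec_uncons (x : Rvec R d.+1) : measurableTypeR R * Rvec R d :=
  (thead x, [tuple of behead x]).

Lemma vec_consK : cancel vec_cons vec_uncons.
Proof. by case=> a x; congr pair => //=; exact: val_inj. Qed.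

Lemma measurable_vec_cons : measurable_fun [set: _] vec_cons.
Proof. by apply: measurable_cons. Qed.

Lemma measurable_vec_uncons : measurable_fun [set: _] vec_uncons.
Proof.
apply/measurable_fun_pairP; split; last exact: measurable_behead.
exact: measurable_tnth.
Qed.

Lemma vcoord_consS p i : vcoord (vec_cons p) (lift ord0 i) = vcoord p.2 i.
Proof. by rewrite /vcoord /= tnthS. Qed.

End vec_cons.

(** The left inverse [g] carries an exhaustion [F] by sets of finite measure over to [T2]: pulling
    [F n] back along [g] and then along [f] returns [F n]. *)
Lemma pushforward_sigma_finite_measure (R : realType) (d1 d2 : measure_display)
    (T1 : measurableType d1) (T2 : measurableType d2)
    (mu : {sigma_finite_measure set T1 -> \bar R}) (f : T1 -> T2) (g : T2 -> T1) :
  measurable_fun setT f -> measurable_fun setT g -> cancel f g ->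
  exists m : {sigma_finite_measure set T2 -> \bar R},
    m = pushforward mu f :> (set T2 -> \bar R).
Proof.
move=> mf mg fK.
have sf : sigma_finite [set: T2] (pushforward mu f).
  have [F TF Foo] := sigma_finiteT mu.
  exists (fun n => g @^-1` F n); first by rewrite -preimage_bigcup -TF preimage_setT.
  move=> n; have [mF Fn] := Foo n; split.
    by rewrite -[_ @^-1` _]setTI; exact: mg.
  rewrite /pushforward -comp_preimage (_ : _ \o _ = idfun)//.
  by apply/funext => p; exact: fK.
pose m : {sigma_finite_measure set T2 -> \bar R} :=
  HB.pack (pushforward mu f) (Measure_isSigmaFinite.Build _ _ _ (pushforward mu f) sf).
by exists (m mf mf mf).
Qed.

(** Both exhaustions are taken increasing, so that a point of [F i] times [G j] already lies in the
    product of index [maxn i j]. *)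
Lemma product_sigma_finite_measure (R : realType) (d1 d2 : measure_display)
    (T1 : measurableType d1) (T2 : measurableType d2)
    (m1 : {sigma_finite_measure set T1 -> \bar R})
    (m2 : {sigma_finite_measure set T2 -> \bar R}) :
  exists m : {sigma_finite_measure set (T1 * T2)%type -> \bar R},
    m = (m1 \x m2)%E :> (set _ -> \bar R).
Proof.
have sf : sigma_finite [set: T1 * T2] (m1 \x m2)%E.
  have /sigma_finiteP[F [TF ndF Foo]] := sigma_finiteT m1.
  have /sigma_finiteP[G [TG ndG Goo]] := sigma_finiteT m2.
  exists (fun n => F n `*` G n).
    apply/seteqP; split=> // -[x y] _.
    have [i _ Fx] : (\bigcup_n F n) x by rewrite -TF.
    have [j _ Gy] : (\bigcup_n G n) y by rewrite -TG.
    exists (maxn i j) => //; split => /=.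
      by move/subsetPset: (ndF _ _ (leq_maxl i j)); exact.
    by move/subsetPset: (ndG _ _ (leq_maxr i j)); exact.
  move=> n; have [mF F_fin] := Foo n; have [mG G_fin] := Goo n.
  split; first exact: measurableX.
  by rewrite product_measure1E// lte_mul_pinfty// ge0_fin_numE.
pose pm := lebesgue_integral_fubini_product_measure1__canonical__measure_function_Measure m1 m2.
pose m : {sigma_finite_measure set (T1 * T2)%type -> \bar R} :=
  HB.pack (m1 \x m2)%E (Measure_isSigmaFinite.Build _ _ _ pm sf).
by exists m.
Qed.

(** [lebesgue_vec] is a bare recursive set function, while the product step needs a sigma-finite
    measure in the lower dimension. Carrying the whole structure through the induction supplies it,
    and the instances below are read off from the witness. *)
Lemma lebesgue_vec_sigma_finite_measure (R : realType) (d : nat) :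
  exists m : {sigma_finite_measure set (Rvec R d) -> \bar R},
    m = @lebesgue_vec R d :> (set _ -> _).
Proof.
elim: d => [|d [m Em]].
  by exists (\d_([tuple] : Rvec R 0)).
have [p Ep] := product_sigma_finite_measure lebesgue_measure m.
have [m' Em'] := pushforward_sigma_finite_measure p
  (@measurable_vec_cons R d) (@measurable_vec_uncons R d) (@vec_consK R d).
by exists m'; rewrite Em' Ep Em.
Qed.

Section lebesgue_vec_measure.
Context (R : realType) (d : nat).

Let lebesgue_vec0 : @lebesgue_vec R d set0 = 0%E.
Proof. by have [m <-] := lebesgue_vec_sigma_finite_measure R d; exact: measure0. Qed.

Let lebesgue_vec_ge0 A : (0 <= @lebesgue_vec R d A)%E.
Proof. by have [m <-] := lebesgue_vec_sigma_finite_measure R d; exact: measure_ge0. Qed.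

Let lebesgue_vec_sigma_additive : semi_sigma_additive (@lebesgue_vec R d).
Proof.
have [m <-] := lebesgue_vec_sigma_finite_measure R d.
exact: measure_semi_sigma_additive.
Qed.

HB.instance Definition _ := isMeasure.Build _ (Rvec R d) R (@lebesgue_vec R d)
  lebesgue_vec0 lebesgue_vec_ge0 lebesgue_vec_sigma_additive.

Let lebesgue_vec_sigma_finite : sigma_finite setT (@lebesgue_vec R d).
Proof.
by have [m <-] := lebesgue_vec_sigma_finite_measure R d; exact: sigma_finiteT.
Qed.

HB.instance Definition _ := Measure_isSigmaFinite.Build _ (Rvec R d) R
  (@lebesgue_vec R d) lebesgue_vec_sigma_finite.

End lebesgue_vec_measure.

Lemma lebesgue_vecS (R : realType) (d : nat) (A : set (Rvec R d.+1)) :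
  lebesgue_vec A = (lebesgue_measure \x @lebesgue_vec R d)%E (@vec_cons R d @^-1` A).
Proof. by []. Qed.

(** The right-hand side is a measure in [A] that gives half-open intervals their length, so
    uniqueness of Lebesgue measure applies. *)
Lemma lebesgue_measure_affine (R : realType) (a c : R) (A : set R) : 0 < c ->
  measurable A ->
  lebesgue_measure A = (c%:E * lebesgue_measure ((fun x : R => (c * x + a)%R) @^-1` A))%E.
Proof.
move=> c0 mA.
have mf : measurable_fun [set: measurableTypeR R]
    (fun x : measurableTypeR R => (c * x + a : measurableTypeR R)).
  by apply: measurable_funD => //; apply: measurable_funM.
pose m : {measure set (measurableTypeR R) -> \bar R} :=
  measure_function_pushforward__canonical__measure_function_Measure
    (@lebesgue_measure R) mf.
pose c' : {nonneg R} := NngNum (ltW c0).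
rewrite -[RHS]/(mscale c' m A).
apply: lebesgue_measure_unique => // X [[u v] _ <-] /=.
rewrite /mscale /= /pushforward.
rewrite (_ : _ @^-1` _ = `](u - a) / c, (v - a) / c]%classic).
  rewrite !lebesgue_measure_itv /= !lte_fin ltr_pM2r ?invr_gt0// ltrD2r.
  case: ifPn => uv; last by rewrite mule0.
  by rewrite -!EFinB -EFinM; congr EFin; field; rewrite gt_eqF.
apply/seteqP; split => x /=; rewrite !in_itv /=.
  by rewrite ltr_pdivrMr// ler_pdivlMr// ltrBlDr lerBrDr [x * c]mulrC.
by rewrite ltr_pdivrMr// ler_pdivlMr// ltrBlDr lerBrDr [x * c]mulrC.
Qed.

(** Induction on [d]: the affine map acts coordinatewise, so the rescaled pushforward of the product
    agrees with the product on rectangles, and product measures are determined by rectangles. *)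
Lemma lebesgue_vec_affine (R : realType) (d : nat) (a : 'I_d -> R) (c : R)
    (A : set (Rvec R d)) : 0 < c -> measurable A ->
  lebesgue_vec A =
  ((c ^+ d)%:E *
    lebesgue_vec ((fun x => vec_of (fun i => (c * vcoord x i + a i)%R)) @^-1` A))%E.
Proof.
move=> c0; elim: d a A => [|d IH] a A mA.
  rewrite expr0 mul1e (_ : (fun x => vec_of _) = idfun)//.
  by apply/funext => x; apply: eq_from_tnth => -[].
have mvec n (b : 'I_n -> R) : measurable_fun [set: Rvec R n]
    (fun x => vec_of (fun i => c * vcoord x i + b i)).
  apply: (measurable_vec_of (f := fun i x => c * vcoord x i + b i)) => i.
  apply: measurable_funD => //; apply: measurable_funM => //.
  exact: measurable_vcoord.
pose f1 (x : measurableTypeR R) : measurableTypeR R := c * x + a ord0.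
have mf1 : measurable_fun setT f1.
  by apply: measurable_funD => //; apply: measurable_funM.
pose f2 (x : Rvec R d) := vec_of (fun i => c * vcoord x i + a (lift ord0 i)).
pose f (p : measurableTypeR R * Rvec R d) := (f1 p.1, f2 p.2).
have mf : measurable_fun setT f.
  apply/measurable_fun_pairP; split.
    by apply: (measurableT_comp mf1).
  by apply: (measurableT_comp (mvec _ _)).
pose m : {measure set (measurableTypeR R * Rvec R d)%type -> \bar R} :=
  measure_function_pushforward__canonical__measure_function_Measure
    (product_measure1 (@lebesgue_measure R) (@lebesgue_vec R d)) mf.
pose c' : {nonneg R} := NngNum (exprn_ge0 d.+1 (ltW c0)).
rewrite !lebesgue_vecS.
rewrite [X in (_ * X)%E](_ : _ = m (@vec_cons R d @^-1` A)); last first.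
  rewrite /m /= /pushforward; congr (product_measure1 _ _ _).
  apply/seteqP; split => p /=.
  - move=> Ap; rewrite (_ : vec_cons _ = vec_of (fun i =>
      c * vcoord (vec_cons p) i + a i))//.
    apply: eq_from_tnth => i; rewrite tnth_mktuple.
    have [->//|[j ->]] : i = ord0 \/ exists j, i = lift ord0 j.
      by case: (unliftP ord0 i) => [j|] ->; [right; exists j|left].
    by rewrite vcoord_consS /= tnthS tnth_mktuple.
  - move=> Ap; rewrite (_ : vec_of _ = vec_cons (f p))//.
    apply: eq_from_tnth => i; rewrite tnth_mktuple.
    have [->//|[j ->]] : i = ord0 \/ exists j, i = lift ord0 j.
      by case: (unliftP ord0 i) => [j|] ->; [right; exists j|left].
    by rewrite vcoord_consS /= tnthS tnth_mktuple.
rewrite -[RHS]/(mscale c' m _).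
apply: product_measure_unique => [A1 A2 mA1 mA2|]; last first.
  by rewrite -[_ @^-1` _]setTI; exact: measurable_vec_cons.
transitivity ((c ^+ d.+1)%:E * (lebesgue_measure \x @lebesgue_vec R d)
  ((f1 @^-1` A1) `*` (f2 @^-1` A2)))%E; first by [].
rewrite product_measure1E; last 2 first.
- by rewrite -[_ @^-1` _]setTI; exact: mf1.
- by rewrite -[_ @^-1` _]setTI; exact: mvec.
rewrite exprS EFinM muleACA; congr mule; last exact/esym/(IH (a \o lift ord0) A2).
exact/esym/(lebesgue_measure_affine (a ord0) c0 mA1).
Qed.

Lemma measurable_box (R : realType) (d : nat) (i : interval R) :
  measurable [set x : Rvec R d | forall j, vcoord x j \in i].
Proof.
rewrite (_ : mkset _ = \bigcap_(j in [set: 'I_d]) (fun x => vcoord x j) @^-1` [set` i]).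
  apply: fin_bigcap_measurable => // j _.
  by rewrite -[_ @^-1` _]setTI; apply: measurable_vcoord.
by apply/seteqP; split => x /= H j; [move=> _; exact: H|exact: H].
Qed.

Lemma lebesgue_vec_box (R : realType) (d : nat) (i : interval R) :
  lebesgue_vec [set x : Rvec R d | forall j, vcoord x j \in i] =
  (lebesgue_measure [set` i] ^+ d)%E.
Proof.
elim: d => [|d IH].
  by rewrite expe0 /= diracE mem_set// => -[].
rewrite lebesgue_vecS expeS -IH.
rewrite (_ : _ @^-1` _ = [set` i] `*` [set x : Rvec R d | forall j, vcoord x j \in i]).
  by rewrite product_measure1E//; exact: measurable_box.
apply/seteqP; split => -[u x] /=.
  move=> H; split; first exact: (H ord0).
  by move=> j; have := H (lift ord0 j); rewrite vcoord_consS.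
move=> [iu ix] j; case: (unliftP ord0 j) => [k|] ->; last exact: iu.
by rewrite vcoord_consS.
Qed.

(** * Euclidean balls *)

Section euclidean_norm.
Context (R : realType) (d : nat).
Implicit Types x y : 'I_d -> R.

Lemma enorm_ge0 x : 0 <= enorm x.
Proof. exact: sqrtr_ge0. Qed.

Lemma sqr_enorm x : enorm x ^+ 2 = \sum_i x i ^+ 2.
Proof. by rewrite sqr_sqrtr// sumr_ge0// => i _; exact: sqr_ge0. Qed.

Lemma eq_enorm x y : x =1 y -> enorm x = enorm y.
Proof. by move=> xy; rewrite /enorm; under eq_bigr do rewrite xy. Qed.

Lemma eq_enorm_lt x y r : x =1 y -> enorm x < r -> enorm y < r.
Proof. by move=> /eq_enorm->. Qed.

Lemma enormZ c x : enorm (fun i => c * x i) = `|c| * enorm x.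
Proof.
rewrite /enorm; under eq_bigr do rewrite exprMn.
by rewrite -mulr_sumr sqrtrM ?sqr_ge0// sqrtr_sqr.
Qed.

Lemma enormN x : enorm (fun i => - x i) = enorm x.
Proof. by rewrite /enorm; under eq_bigr do rewrite sqrrN. Qed.

Lemma ler_coord_enorm x i : `|x i| <= enorm x.
Proof.
rewrite -(@ler_pXn2r _ 2)// ?nnegrE ?enorm_ge0// sqr_enorm real_normK ?num_real//.
by rewrite (bigD1 i)//= lerDl sumr_ge0// => j _; exact: sqr_ge0.
Qed.

(** Cauchy-Schwarz, by expanding the sum of the squares of [b * x i - a * y i] and dividing by
    [2 * a * b]. If [a * b = 0], one of the vectors vanishes. *)
Lemma sum_mul_le_enorm x y : \sum_i x i * y i <= enorm x * enorm y.
Proof.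
set a := enorm x; set b := enorm y.
have a0 : 0 <= a by exact: enorm_ge0.
have b0 : 0 <= b by exact: enorm_ge0.
have : 0 <= \sum_i (b * x i - a * y i) ^+ 2 by rewrite sumr_ge0// => i _; exact: sqr_ge0.
rewrite (eq_bigr (fun i => (b ^+ 2 * x i ^+ 2 + a ^+ 2 * y i ^+ 2) -
   2 * a * b * (x i * y i))); last by move=> i _; ring.
rewrite sumrB big_split /= -!mulr_sumr -!sqr_enorm -/a -/b.
have [ab0|ab0] := eqVneq (a * b) 0.
  have x0 : a = 0 -> forall i, x i = 0.
    by move=> e i; apply/eqP; rewrite -normr_le0 -e ler_coord_enorm.
  have y0 : b = 0 -> forall i, y i = 0.
    by move=> e i; apply/eqP; rewrite -normr_le0 -e ler_coord_enorm.
  move=> _; rewrite ab0 big1// => i _.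
  by move/eqP: ab0; rewrite mulf_eq0 => /orP[]/eqP; [move/x0->|move/y0->]; rewrite ?mul0r ?mulr0.
have abp : 0 < a * b by rewrite lt_def ab0 mulr_ge0.
rewrite (_ : _ - _ = 2 * (a * b) * (a * b - \sum_i x i * y i)); last by ring.
by rewrite pmulr_rge0 ?subr_ge0// mulr_gt0.
Qed.

Lemma ler_enormD x y : enorm (fun i => x i + y i) <= enorm x + enorm y.
Proof.
rewrite -(@ler_pXn2r _ 2)// ?nnegrE ?addr_ge0 ?enorm_ge0// sqr_enorm sqrrD.
under eq_bigr do rewrite sqrrD -mulr_natl.
rewrite !big_split /= -!sqr_enorm lerD2r lerD2l -mulr_sumr -[_ * _ *+ 2]mulr_natl ler_pM2l//.
exact: sum_mul_le_enorm.
Qed.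

Lemma ler_enorm_sum x : enorm x <= \sum_i `|x i|.
Proof.
have s0 : 0 <= \sum_i `|x i| by exact: sumr_ge0.
rewrite -(@ler_pXn2r _ 2)// ?nnegrE ?enorm_ge0// sqr_enorm expr2 mulr_suml.
apply: ler_sum => i _; rewrite -real_normK ?num_real// expr2 ler_wpM2l//.
by rewrite (bigD1 i)//= lerDl sumr_ge0.
Qed.

End euclidean_norm.

Section euclidean_balls.
Context (R : realType) (d : nat).
Implicit Types a b : 'I_d -> R.

Definition eball a (r : R) : set (Rvec R d) :=
  [set x | enorm (fun i => vcoord x i - a i) < r].

Lemma eball_le0 a r : r <= 0 -> eball a r = set0.
Proof.
by move=> r0; apply/seteqP; split=> // x /(le_lt_trans (enorm_ge0 _)); rewrite ltNge r0.
Qed.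

Lemma measurable_eball a r : measurable (eball a r).
Proof.
have [/eball_le0->//|r0] := leP r 0.
rewrite (_ : eball a r =
    (fun x => \sum_i (vcoord x i - a i) ^+ 2) @^-1` `]-oo, r ^+ 2[%classic).
  rewrite -[_ @^-1` _]setTI.
  suff : measurable_fun [set: Rvec R d]
    (fun x => \sum_i (vcoord x i - a i) ^+ 2) by exact.
  apply: measurable_sum => i; apply: measurable_funX.
  by apply: measurable_funB => //; exact: measurable_vcoord.
apply/seteqP; split=> x; rewrite /eball /= in_itv /= -sqr_enorm;
  by rewrite ltr_pXn2r// ?nnegrE ?enorm_ge0// ltW.
Qed.

Lemma lebesgue_vec_translate a (A : set (Rvec R d)) : measurable A ->
  lebesgue_vec ((fun x => vec_of (fun i => vcoord x i + a i)) @^-1` A) = lebesgue_vec A.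
Proof.
move=> mA; rewrite (lebesgue_vec_affine a ltr01 mA) expr1n mul1e.
congr (lebesgue_vec (_ @^-1` A)); apply/funext => x.
by apply: eq_from_tnth => i; rewrite !tnth_mktuple mul1r.
Qed.

Lemma unit_ballE : [set x : Rvec R d | enorm (vcoord x) < 1] = eball (fun=> 0) 1.
Proof.
by apply/seteqP; split=> x; rewrite /eball /=;
  rewrite (@eq_enorm _ _ (fun i => vcoord x i - 0) (vcoord x)) => [//|i]; rewrite subr0.
Qed.

(** [unit_ball_volume] is a [fine], so finiteness must be shown; it follows by enclosing the ball in
    a cube. *)
Lemma lebesgue_vec_unit_ball :
  lebesgue_vec [set x : Rvec R d | enorm (vcoord x) < 1] = (unit_ball_volume R d)%:E.
Proof.
rewrite fineK// ge0_fin_numE//.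
apply: (@le_lt_trans _ _ (lebesgue_vec
    [set x : Rvec R d | forall j, vcoord x j \in `[(-1)%R, 1%R]])).
  apply: le_measure; rewrite ?inE.
  - by rewrite unit_ballE; exact: measurable_eball.
  - exact: measurable_box.
  - move=> x /= x1 j; rewrite in_itv /= -ler_norml.
    by rewrite (le_trans (ler_coord_enorm _ _))// ltW.
by rewrite lebesgue_vec_box lebesgue_measure_itv /= lte_fin gtrN// -EFinB -EFin_expe ltry.
Qed.

Lemma unit_ball_volume_gt0 : 0 < unit_ball_volume R d.
Proof.
rewrite -lte_fin -lebesgue_vec_unit_ball.
(* A cube of side [1 / (d + 1)] fits in the open ball, because its coordinates sum to at most
   [d / (d + 1)], which is less than 1 for [d = 0] as well. *)
apply: (@lt_le_trans _ _ (lebesgue_vec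
    [set x : Rvec R d | forall j, vcoord x j \in `[0%R, d.+1%:R^-1%R]])).
  rewrite lebesgue_vec_box lebesgue_measure_itv /= lte_fin invr_gt0 ltr0n /=.
  by rewrite -EFinB -EFin_expe lte_fin exprn_gt0// subr0 invr_gt0.
apply: le_measure; rewrite ?inE.
- exact: measurable_box.
- by rewrite unit_ballE; exact: measurable_eball.
- move=> x /= H; apply: le_lt_trans (ler_enorm_sum _) _.
  apply: (@le_lt_trans _ _ (\sum_(i < d) d.+1%:R^-1)).
    by apply: ler_sum => i _; have /[!in_itv] /= /andP[? ?] := H i; rewrite ger0_norm.
  by rewrite sumr_const card_ord -[_ *+ _]mulr_natl ltr_pdivrMr// mul1r ltr_nat.
Qed.

Lemma lebesgue_vec_eball a r : 0 < r ->
  lebesgue_vec (eball a r) = (unit_ball_volume R d * r ^+ d)%:E.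
Proof.
move=> r0; rewrite (lebesgue_vec_affine a r0 (measurable_eball a r)).
rewrite mulrC EFinM -lebesgue_vec_unit_ball; congr (_ * lebesgue_vec _)%E.
apply/seteqP; split => x; rewrite /eball /=;
  rewrite (@eq_enorm _ _ (fun i => vcoord _ i - a i) (fun i => r * vcoord x i)) ?enormZ;
  rewrite ?(gtr0_norm r0) ?gtr_pMr//; by move=> i; rewrite vcoord_vec_of addrK.
Qed.

Lemma lebesgue_vec_eballD_translate a b u r s :
  lebesgue_vec (eball (fun i => a i + u i) r `\` eball (fun i => b i + u i) s) =
  lebesgue_vec (eball a r `\` eball b s).
Proof.
rewrite -(lebesgue_vec_translate u); last by apply: measurableD; exact: measurable_eball.
congr lebesgue_vec; have E c t x :
    eball (fun i => c i + u i) t (vec_of (fun i => vcoord x i + u i)) = eball c t x.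
  rewrite /eball /= (@eq_enorm _ _ _ (fun i => vcoord x i - c i))// => i.
  by rewrite vcoord_vec_of opprD addrACA subrr addr0.
by apply/seteqP; split => x /=; rewrite /setD /= !E.
Qed.

(** Passing through the ball about [a + v] splits the difference for [m + 1] steps: one piece is the
    difference for [m] steps translated by [v], the other is a single step. *)
Lemma lebesgue_vec_eballD_chain a v r (m : nat) :
  (lebesgue_vec (eball (fun i => a i + m%:R * v i)%R r `\` eball a r) <=
   m%:R%:E * lebesgue_vec (eball (fun i => a i + v i)%R r `\` eball a r))%E.
Proof.
elim: m => [|m IH].
  rewrite mul0e (_ : (fun i => _) = a) ?setDv ?measure0//.
  by apply/funext => i; rewrite mul0r addr0.
have mD b c : measurable (eball b r `\` eball c r).
  by apply: measurableD; exact: measurable_eball.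
set A := eball _ r `\` _.
apply: (@le_trans _ _ (lebesgue_vec
  ((eball (fun i => (a i + m%:R * v i) + v i)%R r `\` eball (fun i => a i + v i)%R r) `|`
   (eball (fun i => a i + v i)%R r `\` eball a r)))).
  apply: le_measure; rewrite ?inE; [exact: mD|exact: measurableU|].
  rewrite /A (_ : (fun i => a i + m.+1%:R * v i) = (fun i => (a i + m%:R * v i) + v i)).
    by move=> x [xA xN]; have [xv|xv] := pselect (eball (fun i => a i + v i) r x);
      [right|left].
  by apply/funext => i; rewrite -natr1 mulrDl mul1r addrA.
apply: le_trans (measureU2 _ (mD _ _) (mD _ _)) _.
rewrite [X in (X + _)%E](_ : _ = lebesgue_vec
    (eball (fun i => (a i + m%:R * v i)%R) r `\` eball a r)); last first.
  exact: (lebesgue_vec_eballD_translate (fun i => a i + m%:R * v i)).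
rewrite -natr1 EFinD ge0_muleDl ?lee_fin// mul1e.
exact: leeD.
Qed.

(* The chain [a, a + v, .., a + m v] with [m] the first multiple at which the two
   balls are disjoint: subadditivity along it bounds the first step from below. *)
Lemma lebesgue_vec_eballD_ge a v r : 0 < r -> 0 < enorm v <= 2 * r ->
  ((unit_ball_volume R d * r ^+ d * (enorm v / (4 * r)))%:E <=
   lebesgue_vec (eball (fun i => a i + v i)%R r `\` eball a r))%E.
Proof.
move=> r0 /andP[t0 tr]; set t := enorm v in t0 tr *.
pose m := (Num.truncn (2 * r / t)).+1.
have q0 : 0 <= 2 * r / t by rewrite divr_ge0// ?mulr_ge0// ltW.
have m_ge : 2 * r <= m%:R * t.
  by rewrite -ler_pdivrMr// ltW// truncnS_gt.
(* Rounding up costs at most 1, which is at most [2 * r / t] by [tr]. *)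
have m_le : m%:R <= 4 * r / t.
  rewrite (_ : m%:R = (Num.truncn (2 * r / t))%:R + 1); last by rewrite natr1.
  rewrite (@le_trans _ _ (2 * r / t + 1))//.
    by rewrite lerD2r; have /andP[] := truncn_itv q0.
  rewrite (_ : 4 * r / t = 2 * r / t + 2 * r / t); last by field; rewrite gt_eqF.
  by rewrite lerD2l ler_pdivlMr// mul1r.
have m0 : 0 < m%:R :> R by rewrite ltr0n.
have := lebesgue_vec_eballD_chain a v r m.
have -> : eball (fun i => a i + m%:R * v i) r `\` eball a r =
    eball (fun i => a i + m%:R * v i) r.
  apply/seteqP; split => [x []//|x xb]; split => // xa.
  have : m%:R * t < r + r; last by rewrite -mulr2n -[r *+ 2]mulr_natl ltNge m_ge.
  rewrite -[m%:R]ger0_norm// -enormZ -/(enorm _).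
  rewrite (@eq_enorm _ _ _ (fun i => (vcoord x i - a i) +
    - (vcoord x i - (a i + m%:R * v i)))); last by move=> i; ring.
  apply: le_lt_trans (ler_enormD _ _) _.
  by rewrite enormN; exact: ltrD.
rewrite lebesgue_vec_eball// => H.
have : ((unit_ball_volume R d * r ^+ d)%:E <= (4 * r / t)%:E *
    lebesgue_vec (eball (fun i => (a i + v i)%R) r `\` eball a r))%E.
  by apply: le_trans H _; rewrite lee_wpmul2r// lee_fin.
have c0 : 0 < 4 * r / t by rewrite divr_gt0// mulr_gt0.
move=> K; have := @lee_wpmul2l _ (t / (4 * r))%:E _ _ _ K.
rewrite lee_fin ltW ?divr_gt0 ?mulr_gt0// => /(_ isT).
rewrite muleA -!EFinM (_ : t / (4 * r) * (4 * r / t) = 1); last first.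
  by field; rewrite !gt_eqF.
by rewrite mul1e mulrC.
Qed.

End euclidean_balls.

(** * Balls in the torus *)

Section torus_geometry.
Context (R : realType) (d : nat).
Implicit Types (a b : Rvec R d) (x y z : torus R d).

Lemma tproj_eqP a b :
  reflect (exists delta : 'I_d -> int, forall i, vcoord a i = vcoord b i + (delta i)%:~R)
          (tproj a == tproj b).
Proof.
rewrite /tproj; apply: (iffP idP) => [/eqP/eqmodP /= /forallP ab|[delta E]].
  exists (fun i => Num.floor (vcoord a i - vcoord b i)) => i.
  by rewrite (floorK (ab i)) addrC subrK.
apply/eqP/eqmodP; apply/forallP => i.
by rewrite E addrAC subrr add0r; exact: intr_int.
Qed.

Lemma repr_tproj a : exists delta : 'I_d -> int,
  forall i, vcoord (repr (tproj a)) i = vcoord a i + (delta i)%:~R.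
Proof. by apply/tproj_eqP/eqP; rewrite /tproj reprK. Qed.

(** An infimum is below [r] exactly when some member is, which suits open balls. The integer shifts
    between [a], [b] and their canonical representatives are absorbed into [delta]. *)
Lemma torus_ballP r a b : torus_ball r (tproj a) (tproj b) <->
  exists delta : 'I_d -> int,
    enorm (fun i => vcoord b i - vcoord a i + (delta i)%:~R) < r.
Proof.
have [da Ea] := repr_tproj a; have [db Eb] := repr_tproj b.
pose f (delta : 'I_d -> int) :=
  enorm (fun i => vcoord (repr (tproj a)) i - vcoord (repr (tproj b)) i + (delta i)%:~R).
have hinf : has_inf [set f delta | delta in [set: 'I_d -> int]].
  split; first by exists (f (fun=> 0)); exists (fun=> 0).
  by exists 0 => _ [delta _ <-]; exact: enorm_ge0.
rewrite /torus_ball /= /torus_dist; split.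
- move=> /(inf_lt hinf.1)[_ [delta _ <-]]; rewrite /f => H.
  exists (fun i => db i - da i - delta i).
  rewrite -enormN; apply: eq_enorm_lt H => i.
  by rewrite Ea Eb !intrD !intrN; ring.
- move=> [delta H]; apply: le_lt_trans H.
  rewrite -enormN; apply: (le_trans (ge_inf hinf.2 _)).
    exists (fun i => db i - da i - delta i) => //.
  rewrite le_eqVlt; apply/orP; left; apply/eqP; rewrite /f; apply: eq_enorm => i.
  by rewrite Ea Eb !intrD !intrN; ring.
Qed.

Lemma torus_ball_sym r x y : torus_ball r x y -> torus_ball r y x.
Proof.
rewrite -(reprK x) -(reprK y) => /torus_ballP[delta H]; apply/torus_ballP.
exists (fun i => - delta i); rewrite -enormN.
by apply: eq_enorm_lt H => i; rewrite intrN; ring.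
Qed.

Lemma torus_ball_trans r s x y z :
  torus_ball r x y -> torus_ball s y z -> torus_ball (r + s) x z.
Proof.
rewrite -(reprK x) -(reprK y) -(reprK z) => /torus_ballP[d1 H1] /torus_ballP[d2 H2].
apply/torus_ballP; exists (fun i => d1 i + d2 i).
apply: le_lt_trans (ltrD H1 H2); apply: le_trans (ler_enormD _ _).
rewrite le_eqVlt; apply/orP; left; apply/eqP; apply: eq_enorm => i.
by rewrite intrD; ring.
Qed.

(** The shifts range over finite functions because these form a countable type, which makes the
    union measurable. *)
Lemma tproj_preimage_ball r a :
  @tproj R d @^-1` torus_ball r (tproj a) =
  \bigcup_(delta in [set: {ffun 'I_d -> int}])
    eball (fun i => vcoord a i + (delta i)%:~R) r.
Proof.
apply/seteqP; split => [b /= /torus_ballP[delta H]|b [delta _ H]].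
  exists [ffun i => - delta i] => //; rewrite /eball /=.
  rewrite (@eq_enorm _ _ _ (fun i => vcoord b i - vcoord a i + (delta i)%:~R))// => i.
  by rewrite ffunE intrN; ring.
apply/torus_ballP; exists (fun i => - delta i).
rewrite (@eq_enorm _ _ _ (fun i => vcoord b i - (vcoord a i + (delta i)%:~R)))// => i.
by rewrite intrN; ring.
Qed.

Lemma measurable_torus_ball r x : measurable (torus_ball r x).
Proof.
rewrite -(reprK x).
suff : torus_measurable (torus_ball r (tproj (repr x))) by [].
rewrite /torus_measurable /= tproj_preimage_ball; apply: countable_bigcupT_measurable => [|delta].
  exact: countableP.
exact: measurable_eball.
Qed.

Lemma torus_boxE : [set a : Rvec R d | forall i, 0 <= vcoord a i < 1] =
  [set a | forall i, vcoord a i \in `[0, 1[].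
Proof. by apply/seteqP; split => a /= H i; have := H i; rewrite in_itv. Qed.

Lemma measurable_torus_box :
  measurable [set a : Rvec R d | forall i, 0 <= vcoord a i < 1].
Proof. by rewrite torus_boxE; exact: measurable_box. Qed.

Lemma torus_volume_le1 (A : set (torus R d)) : measurable A -> (torus_volume A <= 1)%E.
Proof.
move=> mA; rewrite /torus_volume.
apply: (@le_trans _ _ (lebesgue_vec [set a : Rvec R d | forall i, 0 <= vcoord a i < 1])).
  apply: le_measure; rewrite ?inE; last exact: subIsetl.
    by apply: measurableI => //; exact: measurable_torus_box.
  exact: measurable_torus_box.
rewrite torus_boxE lebesgue_vec_box lebesgue_measure_itv /= lte_fin ltr01.
by rewrite sube0 -EFin_expe expr1n.
Qed.

Lemma int_eq_of_dist_lt1 (p q : int) : `|p%:~R - q%:~R| < 1 :> R -> p = q.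
Proof.
rewrite -intrB -intr_norm -[1]/(1%:~R) ltr_int => H.
by apply/eqP; rewrite -subr_eq0 -normr_le0; lia.
Qed.

(** The Euclidean ball is cut along the integer translates of the unit cube and the pieces [F j] are
    moved into the fundamental domain, where they tile the lift of the torus ball. *)
Lemma torus_volume_ball r a : 0 < r <= 1 / 2 -> (forall i, 0 <= vcoord a i < 1) ->
  torus_volume (torus_ball r (tproj a)) = (unit_ball_volume R d * r ^+ d)%:E.
Proof.
move=> /andP[r0 r12] a01.
(* The shifts -1, 0 and 1 suffice in each coordinate, since the centre lies in the unit cube and [r]
   is at most 1/2. *)
pose sh (j : {ffun 'I_d -> 'I_3}) (i : 'I_d) : int := (j i : nat)%:Z - 1.
pose F j := eball (vcoord a) r `&`
  [set b : Rvec R d | forall i, 0 <= vcoord b i - (sh j i)%:~R < 1].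
pose T j (b : Rvec R d) := vec_of (fun i => vcoord b i + (sh j i)%:~R).
have mF j : measurable (F j).
  apply: measurableI; first exact: measurable_eball.
  rewrite (_ : mkset _ =
    [set b : Rvec R d | forall i, vcoord b i \in `[(sh j i)%:~R, (sh j i)%:~R + 1[]).
    rewrite (_ : mkset _ = \bigcap_(i in [set: 'I_d])
        (fun b : Rvec R d => vcoord b i) @^-1` `[(sh j i)%:~R, (sh j i)%:~R + 1[%classic).
      apply: fin_bigcap_measurable => // i _.
      by rewrite -[_ @^-1` _]setTI; apply: measurable_vcoord.
    by apply/seteqP; split => b /= H i; [move=> _; exact: H|exact: H].
  by apply/seteqP; split => b /= H i; have := H i; rewrite in_itv /= subr_ge0 ltrBlDl.
have mT j : measurable_fun [set: Rvec R d] (T j).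
  apply: (measurable_vec_of (f := fun i b => vcoord b i + (sh j i)%:~R)) => i.
  by apply: measurable_funD => //; exact: measurable_vcoord.
have sh_inj j j' : sh j =1 sh j' -> j = j'.
  move=> E; apply/ffunP => i; apply/val_inj.
  by have /addIr [] := E i.
have sh_surj (delta : 'I_d -> int) : (forall i, `|(delta i)%:~R| < 2 :> R) ->
    exists j, sh j =1 delta.
  move=> H; have D i : -2 < delta i < 2.
    by have := H i; rewrite -intr_norm -[2]/(2%:~R) ltr_int; lia.
  exists [ffun i => inord (absz (delta i + 1))] => i.
  rewrite /sh ffunE inordK; have := D i; lia.
have UF : \bigcup_(j in [set: {ffun 'I_d -> 'I_3}]) F j = eball (vcoord a) r.
  apply/seteqP; split => [b [j _ []]//|b ab].
  have [|j E] := sh_surj (fun i => Num.floor (vcoord b i)).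
    move=> i; have := le_lt_trans (ler_coord_enorm _ i) ab; rewrite ltr_norml => /andP[H1 H2].
    have /andP[H3 H4] := a01 i; have /andP[H5 H6] := floor_itv (vcoord b i).
    by rewrite ltr_norml; move: H5 H6; rewrite intrD; lra.
  exists j => //; split => // i; rewrite E.
  by have /andP[H5 H6] := floor_itv (vcoord b i); move: H5 H6; rewrite intrD; lra.
have UG : \bigcup_(j in [set: {ffun 'I_d -> 'I_3}]) (T j @^-1` F j) =
    [set x : Rvec R d | forall i, 0 <= vcoord x i < 1] `&`
      @tproj R d @^-1` torus_ball r (tproj a).
  apply/seteqP; split => [b [j _ [/= H1 H2]]|b [/= b01 /torus_ballP[delta H]]].
    split => [i|]; first by have := H2 i; rewrite vcoord_vec_of addrK.
    apply/torus_ballP; exists (sh j); apply: eq_enorm_lt H1 => i.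
    by rewrite vcoord_vec_of; ring.
  have [|j E] := sh_surj delta.
    move=> i; have := le_lt_trans (ler_coord_enorm _ i) H; rewrite ltr_norml => /andP[H1 H2].
    by have /andP[H3 H4] := a01 i; have /andP[H5 H6] := b01 i; rewrite ltr_norml; lra.
  exists j => //; split => [|i /=]; last by rewrite vcoord_vec_of addrK.
  rewrite /eball /=; apply: eq_enorm_lt H => i.
  by rewrite vcoord_vec_of E; ring.
rewrite /torus_volume -UG -(lebesgue_vec_eball (vcoord a) r0) -UF.
(* The pieces [F j] are disjoint because the cubes are. Their translates are disjoint because two
   points of a ball of radius at most 1/2 differ by less than 1 in each coordinate, which forces
   equal shifts. *)
rewrite !measure_fin_bigcup//.
- by apply: eq_fsbigr => j _; exact: lebesgue_vec_translate.
- exact: finite_finset.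
- move=> j j' _ _ [b [[_ H1] [_ H2]]]; apply: sh_inj => i.
  by apply: int_eq_of_dist_lt1; have := H1 i; have := H2 i; rewrite ltr_norml; lra.
- exact: finite_finset.
- move=> j j' _ _ [b [[H1 _] [H2 _]]]; apply: sh_inj => i.
  apply: int_eq_of_dist_lt1.
  have := le_lt_trans (ler_coord_enorm _ i) H1; have := le_lt_trans (ler_coord_enorm _ i) H2.
  by rewrite !ltr_norml !vcoord_vec_of; lra.
- by move=> j _; rewrite -[_ @^-1` _]setTI; exact: mT.
Qed.

(** Such a ball does not cross the boundary of the fundamental domain, so volumes of differences of
    central torus balls become Euclidean volumes. *)
Lemma central_torus_ballE r a : 0 < r <= 1 / 4 ->
  (forall i, 1 / 4 <= vcoord a i <= 3 / 4) ->
  [set x : Rvec R d | forall i, 0 <= vcoord x i < 1] `&`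
    @tproj R d @^-1` torus_ball r (tproj a) = eball (vcoord a) r.
Proof.
move=> /andP[r0 r14] aq; apply/seteqP; split => [b [/= b01 /torus_ballP[delta H]]|b H].
  have delta0 i : delta i = 0.
    apply: int_eq_of_dist_lt1; have := le_lt_trans (ler_coord_enorm _ i) H.
    by rewrite !ltr_norml; have := aq i; have := b01 i; lra.
  rewrite /eball /=; apply: eq_enorm_lt H => i.
  by rewrite delta0 addr0.
split => [i /=|].
  have := le_lt_trans (ler_coord_enorm _ i) H; rewrite ltr_norml.
  by have := aq i; lra.
by apply/torus_ballP; exists (fun=> 0); apply: eq_enorm_lt H => i; rewrite addr0.
Qed.

(** Round the fractional part of each coordinate down to a multiple of [1 / M]. Each error is less
    than [1 / M], and the Euclidean norm is at most the sum of the [d] errors. *)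
Lemma torus_grid_dense (M : nat) x : (0 < d)%N -> (0 < M)%N ->
  exists j : {ffun 'I_d -> 'I_M},
    torus_ball (d%:R / M%:R) (tproj (vec_of (fun i => (j i)%:R / M%:R))) x.
Proof.
move=> d0 M0; rewrite -(reprK x); set b := repr x.
have MR : 0 < M%:R :> R by rewrite ltr0n.
pose f i := vcoord b i - (Num.floor (vcoord b i))%:~R.
have f01 i : 0 <= f i < 1.
  by rewrite /f; have := floor_itv (vcoord b i); rewrite intrD; lra.
have Mf0 i : 0 <= M%:R * f i by rewrite mulr_ge0//; have /andP[] := f01 i.
have jM i : (Num.truncn (M%:R * f i) < M)%N.
  rewrite truncn_lt_nat// -[ltRHS]mulr1 ltr_pM2l//.
  by have /andP[] := f01 i.
exists [ffun i => Ordinal (jM i)]; apply/torus_ballP.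
exists (fun i => - Num.floor (vcoord b i)).
apply: le_lt_trans (ler_enorm_sum _) _.
apply: (@lt_le_trans _ _ (\sum_(i < d) M%:R^-1)); last first.
  by rewrite sumr_const card_ord -[_ *+ _]mulr_natl.
apply: ltr_sum => [|i _]; first by apply/hasP; exists (Ordinal d0); rewrite ?mem_index_enum.
rewrite vcoord_vec_of ffunE /= intrN addrAC -/(f i).
have /andP[H1 H2] := truncn_itv (Mf0 i).
rewrite -(ltr_pM2l MR) mulfV ?gt_eqF// -{1}[M%:R]gtr0_norm// -normrM mulrBr.
rewrite [M%:R * (_ / _)]mulrCA mulfV ?gt_eqF// mulr1 ltr_norml.
by move: H2; rewrite -natr1; lra.
Qed.

End torus_geometry.

(** * Poisson counts and the second moment method *)

Section counting_witness.
Context (R : realType) (T : choiceType).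
Implicit Types A B : set T.

(** Infinite sets have count [+oo] and contain finite subsets of every size, so a list of [k]
    distinct witnesses works in both cases. *)
Lemma le_countingP A (k : nat) : (k%:R%:E <= counting A :> \bar R)%E <->
  exists s : seq T, [/\ uniq s, (k <= size s)%N & forall y, y \in s -> A y].
Proof.
rewrite /counting; case: ifPn => [/asboolP fA|/asboolPn iA].
  rewrite lee_fin ler_nat; split => [kA|[s [us ks sA]]].
    exists (finmap.enum_fset (fset_set A)); split => //.
    by move=> y; rewrite in_fset_set// inE.
  apply: (leq_trans ks); apply: uniq_leq_size => // y /sA Ay.
  by rewrite in_fset_set// inE.
split => // _; last exact: leey.
have [B BA kB] := infinite_set_fset k iA.
by exists (finmap.enum_fset B); split => //; exact: BA.
Qed.

Lemma le_counting_mono A B (k : nat) : A `<=` B ->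
  (k%:R%:E <= counting A :> \bar R)%E -> (k%:R%:E <= counting B :> \bar R)%E.
Proof.
move=> AB /le_countingP[s [us ks sA]]; apply/le_countingP; exists s; split => // y /sA.
exact: AB.
Qed.

Lemma counting_ltP A (k : nat) : (counting A < k%:R%:E :> \bar R)%E <->
  exists2 j, (j < k)%N & counting A = j%:R%:E :> \bar R.
Proof.
rewrite /counting; case: ifPn => [fA|iA].
  rewrite lte_fin ltr_nat; split => [jk|[j jk [/eqP]]].
    by eexists; [exact: jk|].
  by rewrite eqr_nat => /eqP ->.
by split => [|[]]; rewrite // ltNge leey.
Qed.

End counting_witness.

Definition pois_lt (R : realType) (k : nat) (mu : R) : R :=
  \sum_(j < k) pois_pmf mu j.

Section poisson_tail.
Context (R : realType).
Implicit Types mu L : R.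

Lemma pois_pmf_ge0 mu j : 0 <= mu -> 0 <= pois_pmf mu j.
Proof. by move=> mu0; rewrite /pois_pmf divr_ge0// mulr_ge0 ?expR_ge0// exprn_ge0. Qed.

Lemma pois_lt_ge0 k mu : 0 <= mu -> 0 <= pois_lt k mu.
Proof. by move=> mu0; rewrite sumr_ge0// => j _; exact: pois_pmf_ge0. Qed.

(** Each of the [k] terms is at most the common bound. The power is taken at [L] and the exponential
    at [mu] because the union bound compares a slightly shrunken ball with the original one. *)
Lemma pois_lt_le k mu L : 0 <= mu <= L -> 1 <= L ->
  pois_lt k mu <= k%:R * (L ^+ k.-1 * expR (- mu)).
Proof.
move=> /andP[mu0 muL] L1.
rewrite -[k in k%:R]card_ord mulr_natl -sumr_const; apply: ler_sum => j _.
rewrite /pois_pmf ler_pdivrMr ?ltr0n ?fact_gt0// [L ^+ _ * _]mulrC -mulrA.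
rewrite ler_pM2l ?expR_gt0//; apply: (@le_trans _ _ (L ^+ k.-1)).
  apply: (@le_trans _ _ (L ^+ j)); first by rewrite lerXn2r// nnegrE (le_trans mu0).
  by rewrite ler_weXn2l// -ltnS (ltn_predK (ltn_ord j)).
by rewrite ler_peMr ?exprn_ge0 ?(le_trans ler01)// ler1n fact_gt0.
Qed.

(** Only the last term, of index [k - 1], is kept. *)
Lemma pois_lt_ge k mu : (0 < k)%N -> 0 <= mu ->
  mu ^+ k.-1 * expR (- mu) / k.-1`!%:R <= pois_lt k mu.
Proof.
case: k => // k _ mu0; rewrite /pois_lt big_ord_recr /= /pois_pmf [mu ^+ k * _]mulrC.
by rewrite lerDr sumr_ge0// => j _; exact: pois_pmf_ge0.
Qed.

Lemma expR_ge_monomial mu j : 0 <= mu -> mu ^+ j / j`!%:R <= expR mu.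
Proof.
case: j => [|j] mu0; first by rewrite expr0 fact0 divr1 -expR0 ler_expR.
apply: (@le_trans _ _ (1 + mu ^+ j.+1 / j.+1`!%:R)); first by rewrite lerDr.
exact: expR_ge1Dxn.
Qed.

(** Half of the exponential absorbs the powers: [(mu / 2)^j / j!] is at most [expR (mu / 2)], and
    the factors [2^j] for [j < k] sum to less than [2^k]. A bound without powers of [mu] is what
    makes the covariances geometric. *)
Lemma pois_lt_le_expR k mu : 0 <= mu -> pois_lt k mu <= 2 ^+ k * expR (- (mu / 2)).
Proof.
move=> mu0; have h j : pois_pmf mu j <= 2 ^+ j * expR (- (mu / 2)).
  rewrite /pois_pmf (_ : - mu = - (mu / 2) - mu / 2); last by field.
  rewrite expRD (_ : mu ^+ j = 2 ^+ j * (mu / 2) ^+ j); last first.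
    by rewrite -exprMn; congr (_ ^+ _); field.
  rewrite (_ : _ * _ * _ / _ = 2 ^+ j * expR (- (mu / 2)) *
    (expR (- (mu / 2)) * ((mu / 2) ^+ j / j`!%:R))); last by ring.
  rewrite ler_piMr ?mulr_ge0 ?expR_ge0 ?exprn_ge0//.
  by rewrite mulrC expRN ler_pdivrMr ?expR_gt0// mul1r expR_ge_monomial// divr_ge0.
elim: k => [|k IH]; first by rewrite /pois_lt big_ord0 mulr_ge0 ?expR_ge0.
rewrite /pois_lt big_ord_recr /= exprS mulr2n 2!mulrDl !mul1r.
exact: lerD.
Qed.

End poisson_tail.

(* Chebyshev's inequality for the number of the events [A i] that occur, in the form
   [S^2 1_C + 2 S Z <= Z^2 + S^2] with [S] the mean of [Z]. *)
Lemma second_moment_avoid (R : realType) (disp : measure_display)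
    (Omega : measurableType disp) (P : probability Omega R) (I : finType)
    (A : I -> set Omega) (C : set Omega) :
  (forall i, measurable (A i)) -> measurable C -> (forall i, A i `&` C = set0) ->
  (\sum_i fine (P (A i))) ^+ 2 * (1 + fine (P C)) <=
  \sum_i \sum_j fine (P (A i `&` A j)).
Proof.
move=> mA mC AC; set S := \sum_i fine (P (A i)).
have Pfin B : measurable B -> P B = (fine (P B))%:E.
  by move=> mB; rewrite fineK// fin_num_measure.
have S0 : 0 <= S by apply: sumr_ge0 => i _; exact: fine_ge0.
have mI (B : set Omega) : measurable B -> measurable_fun setT (fun w => (\1_B w)%:E : \bar R).
  by move=> mB; apply/measurable_EFinP; exact: measurable_indic.
have I0 B (w : Omega) : (0 <= (\1_B w)%:E :> \bar R)%E by rewrite lee_fin.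
have intI B : measurable B -> (\int[P]_w (\1_B w)%:E)%E = P B.
  by move=> mB; rewrite integral_indic// setIT.
pose f1 w := ((S ^+ 2)%:E * (\1_C w)%:E + \sum_i (2 * S)%:E * (\1_(A i) w)%:E)%E.
pose f2 w := (\sum_(p : I * I) (\1_(A p.1 `&` A p.2) w)%:E + (S ^+ 2)%:E)%E : \bar R.
(* With [Z] the number of events that occur: on [C], [Z] vanishes and both sides equal [S^2]; off
   [C], the difference is [(Z - S)^2]. *)
have le12 w : (f1 w <= f2 w)%E.
  rewrite /f1 /f2; under eq_bigr do rewrite -EFinM.
  rewrite !sumEFin -EFinM -!EFinD lee_fin.
  rewrite -mulr_sumr; set Z := \sum_i \1_(A i) w.
  have -> : \sum_(p : I * I) \1_(A p.1 `&` A p.2) w = Z ^+ 2 :> R.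
    rewrite -(pair_bigA _ (fun i j => \1_(A i `&` A j) w)) /= expr2 mulr_suml.
    apply: eq_bigr => i _; rewrite mulr_sumr; apply: eq_bigr => j _.
    by rewrite indicI.
  rewrite [\1_C w]indicE; have [wC|wC] := boolP (w \in C); last first.
    by rewrite mulr0 add0r -subr_ge0 (_ : _ - _ = (Z - S) ^+ 2) ?sqr_ge0//; ring.
  rewrite (_ : Z = 0) ?mulr1; first by rewrite mulr0 addr0 expr0n add0r.
  apply: big1 => i _; rewrite indicE; case: (boolP (w \in A i)) => // wA.
  have : (A i `&` C) w by split; exact: set_mem.
  by rewrite AC.
have m1 : measurable_fun setT (fun w => ((S ^+ 2)%:E * (\1_C w)%:E)%E : \bar R).
  by apply: measurable_funeM; exact: mI.
have m2 i : measurable_fun setT (fun w => ((2 * S)%:E * (\1_(A i) w)%:E)%E : \bar R).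
  by apply: measurable_funeM; exact: mI.
have mf1 : measurable_fun setT f1.
  by apply: emeasurable_funD => //; apply: emeasurable_sum.
have m3 (p : I * I) : measurable_fun setT (fun w => (\1_(A p.1 `&` A p.2) w)%:E : \bar R).
  by apply: mI; exact: measurableI.
have m4 : measurable_fun setT (fun w => (\sum_(p : I * I) (\1_(A p.1 `&` A p.2) w)%:E)%E : \bar R).
  by apply: emeasurable_sum.
have mf2 : measurable_fun setT f2.
  by apply: emeasurable_funD.
have S2 : (0 <= (S ^+ 2)%:E)%E by rewrite lee_fin sqr_ge0.
have twoS : (0 <= (2 * S)%:E)%E by rewrite lee_fin mulr_ge0.
have := @ge0_le_integral _ _ _ P setT measurableT f1 f2.
move=> /(_ _ mf1 mf2 (fun w _ => le12 w)).
have f10 w : setT w -> (0 <= f1 w)%E.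
  by move=> _; rewrite adde_ge0 ?mule_ge0// sume_ge0// => i _; rewrite mule_ge0.
move=> /(_ f10).
rewrite ge0_integralD//; last 3 first.
- by move=> w _; exact: mule_ge0.
- by move=> w _; rewrite sume_ge0// => i _; rewrite mule_ge0.
- by apply: emeasurable_sum.
rewrite ge0_integralD//; last 1 first.
- by move=> w _; rewrite sume_ge0.
rewrite ge0_integralZl//; last exact: mI.
rewrite ge0_integral_sum//; last by move=> i w _; rewrite mule_ge0.
rewrite ge0_integral_sum//.
rewrite (eq_bigr (fun i => (2 * S * fine (P (A i)))%:E)); last first.
  move=> i _; rewrite ge0_integralZl//; last exact: mI.
  by rewrite intI// [in LHS](Pfin _ (mA i)) -EFinM.
rewrite (eq_bigr (fun p => (fine (P (A p.1 `&` A p.2)))%:E)); last first.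
  by move=> p _; rewrite intI; [apply: Pfin|]; exact: measurableI.
have -> : (\int[P]__ (S ^+ 2)%:E = (S ^+ 2)%:E)%E.
  transitivity ((S ^+ 2)%:E * P setT)%E; first exact: (integral_cst P measurableT).
  by rewrite probability_setT mule1.
rewrite intI// Pfin// !sumEFin -EFinM -!EFinD lee_fin.
rewrite -mulr_sumr -/S -(pair_bigA _ (fun i j => fine (P (A i `&` A j)))) /= => H.
by lra.
Qed.

Lemma measure_bigsetU_le (R : realType) (disp : measure_display)
    (T : measurableType disp) (mu : {measure set T -> \bar R}) (I : Type) (s : seq I)
    (A : I -> set T) : (forall i, measurable (A i)) ->
  (mu (\big[setU/set0]_(i <- s) A i) <= \sum_(i <- s) mu (A i))%E.
Proof.
move=> mA; elim: s => [|i s IH]; first by rewrite !big_nil measure0.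
rewrite !big_cons; apply: le_trans (measureU2 _ _ _) _ => //.
  exact: bigsetU_measurable.
exact: leeD.
Qed.

Section poisson_events.
Context (R : realType) (disp : measure_display) (Omega : measurableType disp).
Context (P : probability Omega R) (d : nat) (lambda : R).
Context (X : Omega -> set (torus R d)).
Hypothesis hX : poisson_process P lambda X.
Implicit Types A B : set (torus R d).

Definition few_points (k : nat) A : set Omega :=
  [set w | (point_count X A w < k%:R%:E)%E].

Lemma measurable_few_points k A : measurable A -> measurable (few_points k A).
Proof.
move=> mA; rewrite -[few_points k A]setTI.
rewrite (_ : few_points k A = point_count X A @^-1` [set` `]-oo, k%:R%:E[]).
  apply: (poisson_measurable hX mA measurableT); exact: emeasurable_itv.
by apply/seteqP; split => w /=; rewrite in_itv.
Qed.

Lemma few_points_sub k A B : A `<=` B -> few_points k B `<=` few_points k A.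
Proof.
move=> AB w; rewrite /few_points /= !ltNge; apply: contra.
by apply: le_counting_mono; exact: setSI.
Qed.

Lemma prob_few_points k A : measurable A ->
  P (few_points k A) = (pois_lt k (lambda * fine (torus_volume A)))%:E.
Proof.
move=> mA.
pose F (j : nat) := [set w | point_count X A w = j%:R%:E].
have mF j : measurable (F j).
  rewrite -[F j]setTI (_ : F j = point_count X A @^-1` [set j%:R%:E])//.
  by apply: (poisson_measurable hX mA measurableT).
have -> : few_points k A = \big[setU/set0]_(j < k) F j.
  rewrite -bigcup_mkord; apply/seteqP; split => w.
    by move=> /counting_ltP[j jk E]; exists j.
  by move=> [j jk E]; apply/counting_ltP; exists j.
rewrite measure_bigsetU//.
  rewrite /pois_lt -sumEFin; apply: eq_bigr => j _.
  exact: (poisson_law hX).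
move=> i j _ _ [w [Ei Ej]]; have [/eqP] : i%:R%:E = j%:R%:E :> \bar R by rewrite -Ei -Ej.
by rewrite eqr_nat => /eqP.
Qed.

(** Independence is given for families indexed by ordinals, so the two sets are packed as a family
    over ['I_2]. *)
Lemma prob_few_pointsI k A B : measurable A -> measurable B -> A `&` B = set0 ->
  P (few_points k A `&` few_points k B) = (P (few_points k A) * P (few_points k B))%E.
Proof.
move=> mA mB AB.
pose F (i : 'I_2) := if i == ord0 then A else B.
have mF i : measurable (F i) by rewrite /F; case: ifP.
have tF : trivIset [set: 'I_2] F.
  apply/trivIsetP => i j _ _; rewrite /F.
  case: (eqVneq i ord0) => [->|i0]; case: (eqVneq j ord0) => [_|j0] //.
    by rewrite setIC.
  move: i0 j0; rewrite -!val_eqE /=.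
  by have := ltn_ord i; have := ltn_ord j; lia.
have := poisson_independent hX mF tF (fun=> emeasurable_itv `]-oo, k%:R%:E[).
rewrite big_ord_recl big_ord1 /=.
have E D : point_count X D @^-1` [set` `]-oo, k%:R%:E[] = few_points k D.
  by apply/seteqP; split => w /=; rewrite in_itv.
rewrite /F /= !E => <-; congr (P _); apply/seteqP; split => w.
  move=> [wA wB] i _.
  suff : few_points k (if i == ord0 then A else B) w by rewrite -E.
  by case: ifP.
by move=> H; split; rewrite -E; [exact: (H ord0)|exact: (H (lift ord0 ord0))].
Qed.

End poisson_events.

(** * Measurability of coverage and the union bound *)

Section coverage.
Context (R : realType) (disp : measure_display) (Omega : measurableType disp).
Context (P : probability Omega R) (d : nat) (lambda : R).
Context (X : Omega -> set (torus R d)).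
Hypothesis hX : poisson_process P lambda X.
Hypothesis d_gt0 : (0 < d)%N.

Definition grid_point (M : nat) (j : {ffun 'I_d -> 'I_M}) : Rvec R d :=
  vec_of (fun i => (j i)%:R / M%:R).

Lemma torus_ball_shrink r (s : seq (torus R d)) x :
  (forall y, y \in s -> torus_ball r x y) ->
  exists2 e : R, 0 < e & forall y, y \in s -> torus_ball (r - e) x y.
Proof.
elim: s => [_|y s IH sr]; first by exists 1.
have [z zs|e e0 He] := IH; first by apply: sr; rewrite inE zs orbT.
have yr : torus_dist x y < r by apply: sr; rewrite inE eqxx.
(* Half of the slack at [y] keeps the inequality for the smaller radius strict. *)
exists (Num.min e ((r - torus_dist x y) / 2)).
  by rewrite lt_min e0 divr_gt0// subr_gt0.
move=> z; rewrite inE => /orP[/eqP->|/He zr].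
  rewrite /torus_ball /=.
  have : Num.min e ((r - torus_dist x y) / 2) <= (r - torus_dist x y) / 2.
    by rewrite ge_min lexx orbT.
  by lra.
rewrite /torus_ball /= (lt_le_trans zr)// lerD2l lerN2 ge_min lexx//.
Qed.

(* Lebesgue number argument: each centre has [k] points in its open ball, with some
   room to spare, and compactness of the cube makes that room uniform. *)
Lemma covered_with_margin (k : nat) r (Y : set (torus R d)) :
  (forall x, k_covered k r Y x) ->
  exists m : nat, forall j : {ffun 'I_d -> 'I_m.+1},
    k_covered k (r - d%:R / m.+1%:R) Y (tproj (grid_point j)).
Proof.
move=> cov; have dR : 0 < d%:R :> R by rewrite ltr0n.
(* Compactness of the cube is used in row vectors. Their norm bounds coordinates, so a radius of
   [e / 2 / d] there gives a Euclidean distance below [e / 2]. *)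
pose pt (v : 'rV[R]_d) : torus R d := tproj (vec_of (fun i => v ord0 i)).
pose K := [set v : 'rV[R]_d | forall i, `[0, 1]%classic (v ord0 i)].
have cK : compact K.
  by apply: (@rV_compact R d (fun=> `[0, 1]%classic)) => i; exact: segment_compact.
have := (compact_near_coveringP K).1 cK nat \oo
  (fun m v => k_covered k (r - d%:R / m.+1%:R) Y (pt v)).
case=> [v _|m _ Hm].
  have /le_countingP[s [us ks sY]] := cov (pt v).
  have [|e e0 He] := @torus_ball_shrink r s (pt v); first by move=> y /sY[].
  have e2 : 0 < e / 2 / d%:R by rewrite !divr_gt0.
  near=> v' m; apply/le_countingP; exists s; split => // y ys; split; last by have [] := sY _ ys.
  (* Half of the margin [e] pays for moving the centre from [v] to [v'], the other half for the term
     [d / (m + 1)]. *)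
  rewrite /= (_ : r - _ = (e / 2) + (r - e) + (e / 2 - d%:R / m.+1%:R)); last first.
    by set t := _ / m.+1%:R; lra.
  have v'v : torus_ball (e / 2) (pt v') (pt v).
    apply/torus_ballP; exists (fun=> 0).
    apply: le_lt_trans (ler_enorm_sum _) _.
    apply: (@lt_le_trans _ _ (\sum_(i < d) e / 2 / d%:R)); last first.
      by rewrite sumr_const card_ord -[_ *+ _]mulr_natl mulrCA mulfV ?mulr1// gt_eqF.
    apply: ltr_sum => [|i _]; first by apply/hasP; exists (Ordinal d_gt0); rewrite ?mem_index_enum.
    rewrite !vcoord_vec_of addr0.
    have : ball v (e / 2 / d%:R) v' by near: v'; exact: nbhsx_ballx.
    by case=> _ /(_ ord0 i).
  have yv := torus_ball_trans v'v (He y ys).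
  rewrite /torus_ball /=; apply: (lt_le_trans yv).
  rewrite lerDl subr_ge0 ler_pdivrMr ?ltr0n// mulrC -ler_pdivrMr; last by rewrite divr_gt0.
  apply: (@le_trans _ _ m%:R); last by rewrite ler_nat.
  by near: m; apply: nbhs_infty_ger.
exists m => j; have := Hm m (leqnn m) (\row_i ((j i)%:R / m.+1%:R)) _.
rewrite /pt (_ : vec_of _ = grid_point j).
  apply => i /=; rewrite mxE in_itv /= divr_ge0//= ler_pdivrMr ?ltr0n// mul1r ler_nat.
  exact: ltnW.
by apply: eq_from_tnth => i; rewrite !tnth_mktuple mxE.
Unshelve. all: by end_near.
Qed.

Lemma torus_ball_subset (r s : R) (x y : torus R d) :
  torus_ball s x y -> torus_ball (r - s) x `<=` torus_ball r y.
Proof.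
move=> /torus_ball_sym yx z xz.
by have := torus_ball_trans yx xz; rewrite addrC subrK.
Qed.

(** This exhibits coverage, a condition on uncountably many points, as a countable union of finite
    intersections, hence as measurable. One inclusion is the uniform margin, the other the density
    of the grid. *)
Lemma coverage_eventE k r :
  coverage_event k r X =
  \bigcup_m \bigcap_(j in [set: {ffun 'I_d -> 'I_m.+1}])
    ~` few_points X k (torus_ball (r - d%:R / m.+1%:R) (tproj (grid_point j))).
Proof.
apply/seteqP; split => w.
  move=> cov; have [x|m Hm] := @covered_with_margin k r (X w); first exact: cov.
  by exists m => // j _ /=; rewrite /few_points /=; apply/negP; rewrite -leNgt; exact: Hm.
move=> [m _ Hm] x _.
have [j jx] := torus_grid_dense x d_gt0 (ltn0Sn m).
have /negP := Hm j I; rewrite /few_points /= -leNgt.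
apply: le_counting_mono; apply: setSI; exact: torus_ball_subset.
Qed.

Lemma measurable_coverage_event k r : measurable (coverage_event k r X).
Proof.
rewrite coverage_eventE; apply: bigcupT_measurable => m.
apply: fin_bigcap_measurable; first exact: finite_finset.
move=> j _; apply: measurableC; apply: (measurable_few_points hX).
exact: measurable_torus_ball.
Qed.

Lemma coverage_event_mono k r r' : r <= r' ->
  coverage_event k r X `<=` coverage_event k r' X.
Proof.
move=> rr' w cov x xT; have := cov x xT; rewrite /k_covered /=.
apply: le_counting_mono; apply: setSI => y; rewrite /torus_ball /= => yr.
exact: lt_le_trans yr rr'.
Qed.

Lemma grid_point_in01 M (j : {ffun 'I_d -> 'I_M}) i : 0 <= vcoord (grid_point j) i < 1.
Proof.
have M0 : (0 < M)%N by apply: leq_ltn_trans (ltn_ord (j i)).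
by rewrite vcoord_vec_of divr_ge0//= ltr_pdivrMr ?ltr0n// mul1r ltr_nat.
Qed.

(** A point [x] that is not [k]-covered has a grid point within [d / M]; the ball of radius
    [r - d / M] about the latter lies in the [r]-ball about [x] and so also has fewer than [k]
    points. *)
Lemma prob_uncovered_le_grid k r (M : nat) : (0 < M)%N -> 0 < r - d%:R / M%:R ->
  r - d%:R / M%:R <= 1 / 2 ->
  (P (~` coverage_event k r X) <= (M%:R ^+ d *
    pois_lt k (lambda * (unit_ball_volume R d * (r - d%:R / M%:R) ^+ d)))%:E)%E.
Proof.
move=> M0; set r' := r - _ => r'0 r'2.
pose A (j : {ffun 'I_d -> 'I_M}) := few_points X k (torus_ball r' (tproj (grid_point j))).
have mA j : measurable (A j).
  by apply: (measurable_few_points hX); exact: measurable_torus_ball.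
have PA j : P (A j) = (pois_lt k (lambda * (unit_ball_volume R d * r' ^+ d)))%:E.
  rewrite (prob_few_points hX); last exact: measurable_torus_ball.
  by rewrite torus_volume_ball ?r'0//; exact: grid_point_in01.
apply: (@le_trans _ _ (P (\big[setU/set0]_(j : {ffun 'I_d -> 'I_M}) A j))).
  apply: le_measure; rewrite ?inE.
  - exact/measurableC/measurable_coverage_event.
  - exact: bigsetU_measurable.
  move=> w /=; rewrite -existsNE => -[x] /not_implyP[_ xk].
  have [j jx] := torus_grid_dense x d_gt0 M0.
  rewrite (bigD1 j)//=; left; rewrite /A /few_points /= ltNge; apply/negP => H; apply: xk.
  by move: H; apply: le_counting_mono; apply: setSI; exact: torus_ball_subset.
apply: le_trans (measure_bigsetU_le _ _ mA) _.
rewrite (eq_bigr _ (fun j _ => PA j)) sumEFin lee_fin sumr_const card_ffun !card_ord.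
by rewrite -[_ *+ _]mulr_natl natrX.
Qed.

Lemma bernoulli_ineq (x : R) n : 0 <= x <= 1 -> 1 - n%:R * x <= (1 - x) ^+ n.
Proof.
move=> /andP[x0 x1]; elim: n => [|n IH]; first by rewrite expr0 mul0r subr0.
rewrite exprS; apply: (@le_trans _ _ ((1 - x) * (1 - n%:R * x))); last first.
  by rewrite ler_wpM2l// subr_ge0.
by rewrite -subr_ge0 -natr1 (_ : _ - _ = n%:R * x ^+ 2) ?mulr_ge0 ?sqr_ge0//; ring.
Qed.

Lemma prob_uncovered_le k (r L : R) : L = lambda * unit_ball_volume R d * r ^+ d ->
  0 < lambda -> 0 < r <= 1 / 2 -> 2 <= L ->
  (P (~` coverage_event k r X) <=
    ((2 * d%:R) ^+ d * unit_ball_volume R d * k%:R * expR d%:R *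
     (lambda * L ^+ (d.-1 + k.-1) * expR (- L)))%:E)%E.
Proof.
set om := unit_ball_volume R d; move=> EL l0 /andP[r0 r12] L2.
have om0 : 0 < om by exact: unit_ball_volume_gt0.
have L0 : 0 < L by lra.
have dR : 1 <= d%:R :> R by rewrite ler1n.
have dR0 : 0 < d%:R :> R by lra.
(* Just large enough for [d / M] to be at most [r / L]. Rounding up at most doubles [d * L / r],
   which is at least 1. *)
pose M := (Num.truncn (d%:R * L / r)).+1.
have q0 : 0 <= d%:R * L / r by rewrite divr_ge0 ?mulr_ge0//; exact: ltW.
have Mgt : d%:R * L / r < M%:R by exact: truncnS_gt.
have MR0 : 0 < M%:R :> R by rewrite ltr0n.
have Mle : M%:R <= 2 * d%:R * L / r.
  rewrite (_ : M%:R = (Num.truncn (d%:R * L / r))%:R + 1); last by rewrite natr1.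
  have /andP[H _] := truncn_itv q0.
  have : 1 <= d%:R * L / r by rewrite ler_pdivlMr// mul1r; nra.
  rewrite (_ : 2 * d%:R * L / r = d%:R * L / r + d%:R * L / r); last by ring.
  by lra.
have dM : d%:R / M%:R <= r / L.
  rewrite ler_pdivrMr// mulrAC ler_pdivlMr//.
  by move: Mgt; rewrite ltr_pdivrMr// => /ltW; rewrite [r * _]mulrC.
have dM0 : 0 < d%:R / M%:R :> R by exact: divr_gt0.
have rL : r / L <= r / 2 by rewrite ler_wpM2l ?lef_pV2 ?posrE//; lra.
set r' := r - d%:R / M%:R.
have r'0 : 0 < r' by rewrite /r'; lra.
have r'r : r' <= r by rewrite /r'; lra.
have := @prob_uncovered_le_grid k r M isT r'0 _.
move=> /(_ (le_trans r'r r12)) H; apply: le_trans H _; rewrite lee_fin -/om -/r'.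
set mu := lambda * (om * r' ^+ d).
have mu0 : 0 <= mu by rewrite !mulr_ge0 ?exprn_ge0//; exact: ltW.
have muL : mu <= L.
  by rewrite EL /mu mulrA ler_wpM2l ?lerXn2r ?nnegrE ?mulr_ge0//; exact: ltW.
(* Shrinking the radius by the factor [1 - 1 / L] costs at most [d] in the mean. *)
have muge : L - d%:R <= mu.
  have H1 : r * (1 - L^-1) <= r' by rewrite /r' mulrBr mulr1; lra.
  have H2 : 0 <= L^-1 <= 1 by rewrite invr_ge0 ltW//= invf_le1//; lra.
  have H3 := bernoulli_ineq d H2.
  have H4 : L * (1 - d%:R * L^-1) <= L * (1 - L^-1) ^+ d by rewrite ler_pM2l.
  rewrite mulrBr mulr1 mulrCA mulfV ?mulr1 ?gt_eqF// in H4.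
  apply: (le_trans H4); rewrite {1}EL /mu -!mulrA ler_pM2l// ler_pM2l// -exprMn.
  rewrite lerXn2r ?nnegrE//; last exact: ltW.
  by rewrite mulr_ge0 ?subr_ge0//; [exact: ltW|case/andP: H2].
have := @pois_lt_le _ k mu L; rewrite mu0 muL => /(_ isT).
move=> /(_ (le_trans _ L2)) H.
have {}H := H (ler1n _ 2).
have emu : expR (- mu) <= expR d%:R * expR (- L) by rewrite -expRD ler_expR; lra.
(* This cancels one power of [L], turning [(L / r)^d] into [lambda * om * L^(d-1)]. *)
have rd : (r ^+ d)^-1 = lambda * om / L.
  by rewrite EL; field; rewrite !gt_eqF// exprn_gt0.
have MLe : M%:R ^+ d <= (2 * d%:R) ^+ d * (lambda * om * L ^+ d.-1).
  apply: (@le_trans _ _ ((2 * d%:R * L / r) ^+ d)).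
    by rewrite lerXn2r// nnegrE ?divr_ge0 ?mulr_ge0//; exact: ltW.
  rewrite !exprMn exprVn rd -[in L ^+ d](prednK d_gt0) exprS.
  rewrite le_eqVlt; apply/orP; left; apply/eqP; field; exact: lt0r_neq0.
apply: (@le_trans _ _ ((2 * d%:R) ^+ d * (lambda * om * L ^+ d.-1) *
   (k%:R * (L ^+ k.-1 * (expR d%:R * expR (- L)))))).
  apply: ler_pM => //; [exact: pois_lt_ge0|].
  apply: (le_trans H); rewrite ler_wpM2l// ler_wpM2l// exprn_ge0//; exact: ltW.
by rewrite exprD le_eqVlt; apply/orP; left; apply/eqP; ring.
Qed.

End coverage.

(** * The second moment bound *)

(* One of the two truncated differences vanishes. *)
Definition natdist (a b : nat) : nat := (a - b + (b - a))%N.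

Lemma natdist_normr (R : realDomainType) (a b : nat) :
  (natdist a b)%:R = `|b%:R - a%:R| :> R.
Proof.
rewrite /natdist; have [ab|/ltnW ab] := leqP a b.
  by rewrite (eqP ab) add0n natrB// ger0_norm// subr_ge0 ler_nat.
by rewrite (eqP ab) addn0 natrB// distrC ger0_norm// subr_ge0 ler_nat.
Qed.

Lemma natdist_gt0 (a b : nat) : (0 < natdist a b)%N = (a != b).
Proof. by rewrite /natdist; lia. Qed.

(** Two geometric series, one on each side of [a], each at most [1 / (1 - rho)]. *)
Lemma sum_geometric_natdist (R : realFieldType) (rho : R) (a M : nat) : 0 < rho < 1 ->
  \sum_(m < M) rho ^+ natdist a m <= 2 / (1 - rho).
Proof.
move=> /andP[rho0 rho1].
have c0 : 0 < 1 - rho by rewrite subr_gt0.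
have le1 n : 0 < rho ^+ n <= 1 by rewrite exprn_gt0//= exprn_ile1// ltW.
(* The right-hand side below has increments exactly [(1 - rho) * rho ^+ natdist a M]. *)
suff : (1 - rho) * \sum_(m < M) rho ^+ natdist a m <=
    if (M <= a)%N then rho ^+ (a.+1 - M) else 1 + rho - rho ^+ (M - a).
  rewrite ler_pdivlMr// [X in _ -> X <= _]mulrC => /le_trans; apply.
  by case: ifP => _; [have := le1 (a.+1 - M)%N|have := le1 (M - a)%N]; lra.
elim: M => [|M IH]; first by rewrite big_ord0 mulr0; have := le1 (a.+1 - 0)%N; case/andP => /ltW.
rewrite big_ord_recr /= mulrDr; apply: le_trans (lerD IH (lexx _)) _.
rewrite /natdist; have [Ma|aM|<-] := ltngtP M a.
- rewrite (_ : (M - a)%N = 0%N) ?addn0; last by lia.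
  rewrite (_ : (a.+1 - M)%N = (a - M).+1)%N; last by lia.
  rewrite (_ : (a.+1 - M.+1)%N = (a - M))%N; last by lia.
  by rewrite exprS mulrBl mul1r addrCA subrr addr0.
- rewrite (_ : (a - M)%N = 0%N) ?add0n; last by lia.
  by rewrite subSn ?(ltnW aM)// exprS; lra.
- by rewrite subnn subSn// subnn expr1 expr0; lra.
Qed.

Lemma sum_geometric_grid (R : realFieldType) (rho : R) (d M : nat)
    (i : {ffun 'I_d -> 'I_M}) : 0 < rho < 1 ->
  \sum_(j : {ffun 'I_d -> 'I_M}) \prod_l rho ^+ natdist (i l) (j l) <=
  (2 / (1 - rho)) ^+ d.
Proof.
move=> rho01; rewrite -(bigA_distr_bigA (fun (l : 'I_d) (m : 'I_M) => rho ^+ natdist (i l) m)) /=.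
rewrite -[d in _ ^+ d]card_ord -prodr_const; apply: ler_prod => l _.
rewrite sum_geometric_natdist// andbT sumr_ge0// => m _.
by rewrite exprn_ge0//; case/andP: rho01 => /ltW.
Qed.

Section uncovered_grid.
Context (R : realType) (disp : measure_display) (Omega : measurableType disp).
Context (P : probability Omega R) (d : nat) (lambda : R).
Context (X : Omega -> set (torus R d)).
Hypothesis hX : poisson_process P lambda X.
Hypothesis d_gt0 : (0 < d)%N.
Hypothesis lambda_gt0 : 0 < lambda.

(** The offset 1/4, together with [h * M <= 1 / 2], keeps the grid inside the cube where
    [central_torus_ballE] applies. *)
Definition central_grid (h : R) (M : nat) (j : {ffun 'I_d -> 'I_M}) : Rvec R d :=
  vec_of (fun i => 1 / 4 + h * (j i)%:R).

Definition uncovered_at (k : nat) (r h : R) (M : nat) (j : {ffun 'I_d -> 'I_M}) :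
    set Omega :=
  few_points X k (torus_ball r (tproj (central_grid h j))).

Lemma torus_volume_ballD (r : R) (a b : Rvec R d) : 0 < r <= 1 / 4 ->
  (forall i, 1 / 4 <= vcoord a i <= 3 / 4) -> (forall i, 1 / 4 <= vcoord b i <= 3 / 4) ->
  torus_volume (torus_ball r (tproj b) `\` torus_ball r (tproj a)) =
  lebesgue_vec (eball (vcoord b) r `\` eball (vcoord a) r).
Proof.
move=> r0 ha hb; rewrite /torus_volume -(central_torus_ballE r0 ha) -(central_torus_ballE r0 hb).
congr lebesgue_vec; apply/seteqP; split => x /=; first by move=> [x01 [xb xa]]; split=> // -[].
by move=> [[x01 xb] xa]; split => //; split => // xa'; apply: xa.
Qed.

Lemma torus_volume_fin (A : set (torus R d)) : measurable A ->
  torus_volume A = (fine (torus_volume A))%:E.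
Proof.
move=> mA; rewrite fineK// ge0_fin_numE; last exact: measure_ge0.
by apply: le_lt_trans (torus_volume_le1 mA) _; rewrite ltry.
Qed.

Lemma fine_torus_volume_ge0 (A : set (torus R d)) : 0 <= fine (torus_volume A).
Proof. by apply: fine_ge0; exact: measure_ge0. Qed.

(* The balls around two distinct grid points differ in volume by at least a constant
   times [r^(d-1)] times the distance of the centres, until they are disjoint. *)
Lemma pair_uncovered_le (k M : nat) (r h L : R) (i j : {ffun 'I_d -> 'I_M}) :
  L = lambda * unit_ball_volume R d * r ^+ d ->
  0 < r <= 1 / 4 -> h * L = r -> 0 < L -> h * M%:R <= 1 / 2 ->
  fine (P (uncovered_at k r h i `&` uncovered_at k r h j)) <=
  pois_lt k L ^+ 2 + pois_lt k L * 2 ^+ k * \prod_l expR (- (8 * d%:R)^-1) ^+ natdist (i l) (j l).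
Proof.
set om := unit_ball_volume R d.
move=> EL /andP[r0 r14] hL L0 hM; set p := pois_lt k L; set rho := expR _.
pose B (s : {ffun 'I_d -> 'I_M}) := torus_ball r (tproj (central_grid h s)).
rewrite /uncovered_at -/(B i) -/(B j).
have om0 : 0 < om by exact: unit_ball_volume_gt0.
have h0 : 0 < h by rewrite -(pmulr_lgt0 _ L0) hL.
have dR0 : 0 < d%:R :> R by rewrite ltr0n.
have p0 : 0 <= p by apply: pois_lt_ge0; exact: ltW.
have r01 : 0 < r <= 1 / 4 by rewrite r0.
have central (s : {ffun 'I_d -> 'I_M}) l : 1 / 4 <= vcoord (central_grid h s) l <= 3 / 4.
  rewrite vcoord_vec_of.
  have : 0 <= h * (s l)%:R <= h * M%:R.
    by rewrite mulr_ge0 ?(ltW h0)//= ler_pM2l// ler_nat ltnW.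
  by lra.
have mB s : measurable (B s) by exact: measurable_torus_ball.
have volB s : torus_volume (B s) = (om * r ^+ d)%:E.
  rewrite torus_volume_ball//; first by rewrite r0; lra.
  by move=> l; have := central s l; lra.
have PB s : P (few_points X k (B s)) = p%:E.
  by rewrite (prob_few_points hX)// volB /p EL /= mulrA.
have prod0 : 0 <= \prod_l rho ^+ natdist (i l) (j l).
  by apply: prodr_ge0 => l _; rewrite exprn_ge0// expR_ge0.
(* On the diagonal the product is 1, and [p] is absorbed by [p * 2 ^+ k]. *)
have [<-|ij] := eqVneq i j.
  rewrite setIid PB /= big1 => [|l _]; last by rewrite /natdist subnn expr0.
  rewrite mulr1; apply: ler_wpDl; first exact: sqr_ge0.
  by rewrite ler_peMr// exprn_ege1// ler1n.
pose D := B j `\` B i.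
have mD : measurable D by exact: measurableD.
have PD : P (few_points X k D) = (pois_lt k (lambda * fine (torus_volume D)))%:E.
  by rewrite (prob_few_points hX).
have PIJ : fine (P (few_points X k (B i) `&` few_points X k (B j))) <=
    p * pois_lt k (lambda * fine (torus_volume D)).
  rewrite -lee_fin fineK ?fin_num_measure//; last first.
    by apply: measurableI; exact: (measurable_few_points hX).
  rewrite EFinM -(PB i) -PD -(prob_few_pointsI hX)//; last first.
    by apply/seteqP; split => // x [xi [_]].
  apply: le_measure; rewrite ?inE; [| |].
  - by apply: measurableI; exact: (measurable_few_points hX).
  - by apply: measurableI; exact: (measurable_few_points hX).
  by apply: setIS; apply: few_points_sub; exact: subDsetl.
apply: le_trans PIJ _.
pose v l := vcoord (central_grid h j) l - vcoord (central_grid h i) l.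
have vE l : `|v l| = h * (natdist (i l) (j l))%:R.
  rewrite natdist_normr /v !vcoord_vec_of -(gtr0_norm h0) -normrM (gtr0_norm h0).
  by congr `|_|; ring.
have bE : vcoord (central_grid h j) = (fun l => vcoord (central_grid h i) l + v l).
  by apply/funext => l; rewrite /v addrC subrK.
have volD : torus_volume D = lebesgue_vec
    (eball (fun l => vcoord (central_grid h i) l + v l) r `\` eball (vcoord (central_grid h i)) r).
  by rewrite -bE; exact: torus_volume_ballD.
have t0 : 0 < enorm v.
  have /existsP[l il] : [exists l, i l != j l].
    apply: contraR ij; rewrite negb_exists => /forallP H.
    by apply/eqP/ffunP => l; have := H l; rewrite negbK => /eqP.
  by apply: lt_le_trans (ler_coord_enorm v l); rewrite vE mulr_gt0// ltr0n natdist_gt0.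
(* Close centres. In the rate [8 * d], the 4 comes from the volume of the difference, the 2 from the
   halved exponent in [pois_lt_le_expR], and [d] from comparing the sum of the coordinate distances
   with the Euclidean norm; [h * L = r] removes [L] and [r]. *)
have [tr|tr] := leP (enorm v) (2 * r).
  apply: ler_wpDl; first exact: sqr_ge0.
  rewrite -mulrA ler_wpM2l//; apply: le_trans (pois_lt_le_expR _ _) _.
    by rewrite mulr_ge0 ?fine_torus_volume_ge0// ltW.
  rewrite ler_wpM2l ?exprn_ge0//.
  have -> : \prod_l rho ^+ natdist (i l) (j l) =
      expR (- ((8 * d%:R)^-1 * \sum_l (natdist (i l) (j l))%:R)).
    rewrite /rho -mulNr mulr_sumr expR_sum; apply: eq_bigr => l _.
    by rewrite -expRM_natr.
  rewrite ler_expR lerN2.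
  have := @lebesgue_vec_eballD_ge R d (vcoord (central_grid h i)) v r r0.
  rewrite t0 tr => /(_ isT); rewrite -volD torus_volume_fin// lee_fin -/om => Hvol.
  have Hsum : h * \sum_l (natdist (i l) (j l))%:R <= d%:R * enorm v.
    rewrite mulr_sumr -[d in d%:R]card_ord mulr_natl -sumr_const.
    by apply: ler_sum => l _; rewrite -vE; exact: ler_coord_enorm.
  have Hl : lambda * (om * r ^+ d * (enorm v / (4 * r))) <= lambda * fine (torus_volume D).
    by rewrite ler_pM2l.
  apply: (@le_trans _ _ (lambda * (om * r ^+ d * (enorm v / (4 * r))) / 2)); last first.
    by rewrite ler_pM2r.
  have -> : lambda * (om * r ^+ d * (enorm v / (4 * r))) / 2 =
      L * (d%:R * enorm v) / (8 * r * d%:R).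
    by rewrite EL; field; rewrite !gt_eqF.
  apply: (@le_trans _ _ (L * (h * \sum_l (natdist (i l) (j l))%:R) / (8 * r * d%:R))).
    rewrite le_eqVlt; apply/orP; left; apply/eqP; rewrite -hL.
    by field; rewrite !gt_eqF.
  by rewrite ler_pM2r ?invr_gt0 ?mulr_gt0// ler_pM2l.
(* Distant centres: the balls are disjoint, so [D] is a whole ball and the bound is [p ^+ 2]. *)
have -> : pois_lt k (lambda * fine (torus_volume D)) = p.
  rewrite volD setDidl.
    by rewrite lebesgue_vec_eball//= /p EL mulrA.
  apply/seteqP; split => // x [xb xa].
  have : enorm v < 2 * r; last by rewrite ltNge (ltW tr).
  rewrite (@eq_enorm _ _ _ (fun l => (vcoord x l - vcoord (central_grid h i) l) +
    - (vcoord x l - (vcoord (central_grid h i) l + v l)))); last by move=> l; ring.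
  apply: le_lt_trans (ler_enormD _ _) _.
  by rewrite enormN mulr_natl mulr2n; exact: ltrD.
by rewrite expr2 lerDl !mulr_ge0.
Qed.

(** The mean number of failing grid points is [M^d * pois_lt k L], and its second moment exceeds the
    square of the mean by at most the right-hand side times the mean. *)
Lemma prob_covered_le_grid (k M : nat) (r h L : R) : (0 < k)%N -> (0 < M)%N ->
  L = lambda * unit_ball_volume R d * r ^+ d ->
  0 < r <= 1 / 4 -> h * L = r -> 0 < L -> h * M%:R <= 1 / 2 ->
  M%:R ^+ d * pois_lt k L * fine (P (coverage_event k r X)) <=
  2 ^+ k * (2 / (1 - expR (- (8 * d%:R)^-1))) ^+ d.
Proof.
move=> k0 M0 EL r01 hL L0 hM; set K := _ * _ ^+ d.
set p := pois_lt k L; set C := coverage_event k r X; set rho := expR _ in K *.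
have dR0 : 0 < d%:R :> R by rewrite ltr0n.
have rho01 : 0 < rho < 1.
  by rewrite expR_gt0 -expR0 ltr_expR oppr_lt0 invr_gt0 mulr_gt0.
have p0 : 0 < p.
  apply: lt_le_trans (pois_lt_ge k0 (ltW L0)).
  by rewrite !mulr_gt0 ?exprn_gt0 ?expR_gt0 ?invr_gt0 ?ltr0n ?fact_gt0.
pose A := @uncovered_at k r h M.
have mA i : measurable (A i) by apply: (measurable_few_points hX); exact: measurable_torus_ball.
have mC : measurable C by exact: (measurable_coverage_event hX).
have AC i : A i `&` C = set0.
  apply/seteqP; split => // w [Aw Cw]; have := Cw (tproj (central_grid h i)) I.
  by rewrite /k_covered /= leNgt; move: Aw => /= ->.
have PA i : fine (P (A i)) = p.
  rewrite /A /uncovered_at (prob_few_points hX) /=; last exact: measurable_torus_ball.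
  rewrite torus_volume_ball /= ?mulrA -?EL//; first by move: r01; lra.
  move=> l; rewrite vcoord_vec_of.
  have h0 : 0 < h by rewrite -(pmulr_lgt0 _ L0) hL; case/andP: r01.
  have : 0 <= h * (i l)%:R <= h * M%:R.
    by rewrite mulr_ge0 ?(ltW h0)//= ler_pM2l// ler_nat ltnW.
  by lra.
have := second_moment_avoid P mA mC AC.
rewrite (eq_bigr (fun=> p)) ?sumr_const ?card_ffun ?card_ord; last by move=> i _; exact: PA.
set N := (M ^ d)%N.
have NE : N%:R = M%:R ^+ d :> R by rewrite /N natrX.
have N0 : 0 < N%:R :> R by rewrite NE exprn_gt0// ltr0n.
have PC0 : 0 <= fine (P C) by exact: fine_ge0.
rewrite -[p *+ N]mulr_natl => /le_trans H.
have {}H : (N%:R * p) ^+ 2 * (1 + fine (P C)) <= N%:R * (N%:R * p ^+ 2 + p * K).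
  apply: H; rewrite -[N in X in _ <= X * _](_ : #|{ffun 'I_d -> 'I_M}| = N); last first.
    by rewrite card_ffun !card_ord.
  rewrite [leRHS]mulr_natl -sumr_const; apply: ler_sum => i _.
  apply: (@le_trans _ _ (\sum_(j : {ffun 'I_d -> 'I_M})
      (p ^+ 2 + p * 2 ^+ k * \prod_l rho ^+ natdist (i l) (j l)))).
    by apply: ler_sum => j _; exact: (@pair_uncovered_le k M r h L i j EL r01 hL L0 hM).
  rewrite big_split /= sumr_const card_ffun !card_ord -[_ *+ _]mulr_natl lerD2l.
  rewrite -mulr_sumr /K mulrA ler_wpM2l ?mulr_ge0 ?exprn_ge0 ?(ltW p0)//.
  exact: sum_geometric_grid.
(* Multiplying the goal by the mean [N * p] turns it into [H] with [(N * p)^2] cancelled on both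
   sides. *)
rewrite -NE -(ler_pM2l (mulr_gt0 N0 p0)).
have := H; rewrite mulrDr mulr1 mulrDr.
rewrite (_ : N%:R * (N%:R * p ^+ 2) = (N%:R * p) ^+ 2) ?lerD2l; last by ring.
by rewrite expr2 !mulrA.
Qed.

Lemma prob_covered_le (k : nat) (r L : R) : (0 < k)%N ->
  L = lambda * unit_ball_volume R d * r ^+ d -> 0 < r <= 1 / 4 -> 1 <= L ->
  fine (P (coverage_event k r X)) <=
  (4 ^+ d * k.-1`!%:R * 2 ^+ k * (2 / (1 - expR (- (8 * d%:R)^-1))) ^+ d /
    unit_ball_volume R d) /
  (lambda * L ^+ (d.-1 + k.-1) * expR (- L)).
Proof.
set om := unit_ball_volume R d; set K := 2 / (1 - _).
move=> k0 EL /andP[r0 r14] L1.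
have L0 : 0 < L by lra.
have om0 : 0 < om by exact: unit_ball_volume_gt0.
pose h := r / L.
have h0 : 0 < h by exact: divr_gt0.
have hL : h * L = r by rewrite /h divfK// gt_eqF.
have h14 : h <= 1 / 4 by rewrite /h ler_pdivrMr//; nra.
(* The largest [M] with [h * M <= 1 / 2]. Since [h <= 1 / 4], rounding down loses at most half of
   [1 / (2 * h)], which gives [Mge]. *)
pose M := Num.truncn ((2 * h)^-1).
have q0 : 0 <= (2 * h)^-1 by rewrite invr_ge0 mulr_ge0// ltW.
have /andP[Mle _] := truncn_itv q0.
have Mgt : (2 * h)^-1 < M%:R + 1 by rewrite natr1; exact: truncnS_gt.
have q2 : 2 <= (2 * h)^-1.
  move: (h) h0 h14 => x x0 x14; rewrite -div1r ler_pdivlMr ?mulr_gt0//.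
  by rewrite mulrA (_ : 2 * 2 = 4); [lra|ring].
have Mge : (4 * h)^-1 <= M%:R.
  have -> : (4 * h)^-1 = (2 * h)^-1 / 2 by field; rewrite gt_eqF.
  by lra.
have M0 : (0 < M)%N.
  by rewrite -(ltr0n R); apply: lt_le_trans Mge; rewrite invr_gt0 mulr_gt0.
have hM : h * M%:R <= 1 / 2.
  apply: (@le_trans _ _ (h * (2 * h)^-1)); first by rewrite ler_pM2l.
  by rewrite le_eqVlt; apply/orP; left; apply/eqP; field; rewrite gt_eqF.
have H := prob_covered_le_grid k0 M0 EL _ hL L0 hM.
have {}H := H (introT andP (conj r0 r14)).
set C := fine _ in H *; have C0 : 0 <= C by exact: fine_ge0.
have fact0 : 0 < k.-1`!%:R :> R by rewrite ltr0n fact_gt0.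
have Lk : 0 < L ^+ k.-1 * expR (- L) / k.-1`!%:R.
  by rewrite !mulr_gt0 ?exprn_gt0 ?expR_gt0 ?invr_gt0.
have M4 : 0 < (4 * h)^-1 ^+ d by rewrite exprn_gt0// invr_gt0 mulr_gt0.
have low : (4 * h)^-1 ^+ d * (L ^+ k.-1 * expR (- L) / k.-1`!%:R) <= M%:R ^+ d * pois_lt k L.
  apply: ler_pM; [exact: ltW|exact: ltW| |exact/(pois_lt_ge k0)/ltW].
  by rewrite lerXn2r// nnegrE// invr_ge0 mulr_ge0// ltW.
have hd : (4 * h)^-1 ^+ d = lambda * om * L ^+ d.-1 / 4 ^+ d.
  have rd : (r ^+ d)^-1 = lambda * om / L.
    by rewrite EL; field; rewrite !gt_eqF// exprn_gt0.
  rewrite /h exprVn exprMn expr_div_n -[in L ^+ d](prednK d_gt0) exprS invfM invf_div mulrC.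
  rewrite [_ / r ^+ d](_ : _ = L * L ^+ d.-1 * (r ^+ d)^-1)// rd.
  by field; rewrite !gt_eqF// ?exprn_gt0.
rewrite hd in low.
have den0 : 0 < lambda * L ^+ (d.-1 + k.-1) * expR (- L).
  by rewrite !mulr_gt0 ?exprn_gt0 ?expR_gt0.
rewrite ler_pdivlMr//.
have H2 := le_trans (ler_wpM2r C0 low) H.
have E : lambda * om * L ^+ d.-1 / 4 ^+ d * (L ^+ k.-1 * expR (- L) / k.-1`!%:R) * C =
   C * (lambda * L ^+ (d.-1 + k.-1) * expR (- L)) * (om / 4 ^+ d / k.-1`!%:R).
  by rewrite exprD; ring.
have c0 : 0 < om / 4 ^+ d / k.-1`!%:R by rewrite !divr_gt0 ?exprn_gt0.
rewrite E -ler_pdivlMr// in H2; apply: le_trans H2 _.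
rewrite le_eqVlt; apply/orP; left; apply/eqP; rewrite -/K.
by field; rewrite !gt_eqF ?exprn_gt0.
Qed.

End uncovered_grid.

(** * Asymptotics *)

Section asymptotics.
Context (R : realType).
Implicit Types l s x : R.

(** For [l = ln n] and [x] the mean, the left-hand side is the order of the expected number of
    failing grid points. The [ln l] term of the exponent is exactly what turns [x^m] into
    [(x / l)^m]. *)
Lemma critical_intensityE l s x (m : nat) : 0 < l ->
  expR l * x ^+ m * expR (- (l + m%:R * ln l + s)) = (x / l) ^+ m * expR (- s).
Proof.
move=> l0; rewrite !opprD !expRD expr_div_n.
have -> : expR (- (m%:R * ln l)) = (l ^+ m)^-1.
  by rewrite expRN mulrC expRM_natr lnK.
by rewrite (expRN l); field; rewrite ?expf_neq0 ?gt_eqF ?expR_gt0.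
Qed.

(** As [ln l <= l] and [l >= 1], the ratio of the mean to [l] is at most [y = m + 1 + w]. Then
    [y^(m+1) <= (m+1)! * expR y] beats [y^m * expR (- w)], so the bound holds for [w] of any
    size. *)
Lemma supercritical_le l w (m : nat) : 1 <= l -> 0 <= w ->
  expR l * (l + m%:R * ln l + w) ^+ m * expR (- (l + m%:R * ln l + w)) <=
  expR m.+1%:R * m.+1`!%:R / (m.+1%:R + w).
Proof.
move=> l1 w0; have l0 : 0 < l by lra.
rewrite critical_intensityE//; set y := m.+1%:R + w.
have y0 : 0 < y by rewrite /y ltr_wpDr// ltr0n.
have ln0 : 0 <= ln l by rewrite ln_ge0.
have lnl : ln l <= l by rewrite ltW// ln_sublinear.
have m0 : 0 <= m%:R :> R by [].
have ratio : (l + m%:R * ln l + w) / l <= y.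
  by rewrite ler_pdivrMr// /y -natr1; nra.
have ratio0 : 0 <= (l + m%:R * ln l + w) / l.
  by rewrite divr_ge0 ?addr_ge0 ?mulr_ge0// ltW.
apply: (@le_trans _ _ (y ^+ m * expR (- w))).
  by rewrite ler_pM2r ?expR_gt0// lerXn2r// nnegrE ltW.
have := expR_ge_monomial m.+1 (ltW y0); rewrite ler_pdivrMr ?ltr0n ?fact_gt0// => H.
rewrite ler_pdivlMr// (_ : - w = m.+1%:R - y); last by rewrite /y; ring.
rewrite expRD mulrAC -exprSr [_ ^+ _ * _]mulrC -mulrA ler_pM2l ?expR_gt0//.
by rewrite expRN mulrC ler_pdivrMr ?expR_gt0// mulrC.
Qed.

(** The condition [w <= l / 2] keeps the ratio of the mean to [l] at least 1/2, and [expR w] is at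
    least [w]. *)
Lemma subcritical_ge l w (m : nat) : 1 <= l -> 0 <= w <= l / 2 ->
  w / 2 ^+ m <=
  expR l * (l + m%:R * ln l - w) ^+ m * expR (- (l + m%:R * ln l - w)).
Proof.
move=> l1 /andP[w0 wl]; have l0 : 0 < l by lra.
rewrite critical_intensityE// opprK mulrC.
have ln0 : 0 <= m%:R * ln l by rewrite mulr_ge0// ln_ge0.
apply: ler_pM => //.
- by rewrite -exprVn lerXn2r ?nnegrE ?ler_pdivlMr//; lra.
- by apply: le_trans (expR_ge1Dx _); rewrite lerDr.
Qed.

(** With [l = ln n], this says that [n] outgrows [(ln n)^2 / 2], which later forces the enlarged
    radius below 1/4. *)
Lemma ler_ln_expR l : 0 < l -> l * (l / 2) <= expR l.
Proof.
move=> l0; have := expR_ge_monomial 2 (ltW l0).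
by rewrite expr2 (_ : 2`!%:R = 2 :> R)// mulrA.
Qed.

Lemma near_le_ln (A : R) : \forall n \near \oo, A <= ln n%:R.
Proof.
near=> n; rewrite -[A]expRK ler_ln ?posrE ?expR_gt0//.
  by near: n; exact: nbhs_infty_ger.
apply: (@lt_le_trans _ _ (expR A)); first exact: expR_gt0.
by near: n; exact: nbhs_infty_ger.
Unshelve. all: by end_near.
Qed.

Lemma cvg0_le_div (K : R) (u v : nat -> R) : 0 <= K -> v n @[n --> \oo] --> +oo ->
  (\forall n \near \oo, 0 <= u n <= K / v n) -> u n @[n --> \oo] --> 0.
Proof.
move=> K0 /cvgryPge vy uv; apply/cvgrPdist_le => e e0.
near=> n; rewrite sub0r normrN.
have /andP[u0 uK] : 0 <= u n <= K / v n by near: n.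
rewrite ger0_norm//; apply: (le_trans uK).
(* The numerator is [K + 1] so that the threshold is positive even when [K = 0]. *)
have vK : (K + 1) / e <= v n by near: n; exact: vy.
have v0 : 0 < v n by apply: lt_le_trans vK; rewrite divr_gt0// ltr_wpDl.
rewrite ler_pdivrMr// mulrC -ler_pdivrMr//; apply: le_trans vK.
by rewrite ler_pM2r ?invr_gt0// lerDl.
Unshelve. all: by end_near.
Qed.

End asymptotics.

(** * The two regimes of the coverage probability *)

Section main_limits.
Context (R : realType) (d k : nat) (hd : (1 <= d)%N) (hk : (1 <= k)%N).
Context (disp : nat -> measure_display) (Omega : forall n, measurableType (disp n)).
Context (P : forall n, probability (Omega n) R) (X : forall n, Omega n -> set (torus R d)).
Hypothesis hX : forall n, (0 < n)%N -> poisson_process (P n) n%:R (@X n).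
Context (r w : nat -> R).
Hypothesis hr_pos : forall n, 0 < r n.
Hypothesis hw : w n @[n --> \oo] --> +oo.

Let om := unit_ball_volume R d.
Let m := (d.-1 + k.-1)%N.
Local Notation C n := (coverage_event k (r n) (@X n)).

Lemma near_coverage_fin_num : \forall n \near \oo, P n (C n) \is a fin_num.
Proof.
near=> n; have n0 : (0 < n)%N by near: n; exists 1%N.
by apply: fin_num_measure; exact: (measurable_coverage_event (hX n0) hd).
Unshelve. all: by end_near.
Qed.

Lemma coverage_cvg1 : r n @[n --> \oo] --> 0 ->
  (\forall n \near \oo,
    n%:R * om * r n ^+ d = ln n%:R + m%:R * ln (ln n%:R) + w n) ->
  P n (C n) @[n --> \oo] --> 1%E.
Proof.
move=> /cvgrPdist_le hr hL; apply/fine_cvgP; split; first exact: near_coverage_fin_num.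
pose K0 := (2 * d%:R) ^+ d * om * k%:R * expR d%:R.
pose K := K0 * (expR m.+1%:R * m.+1`!%:R).
have om0 : 0 < om by exact: unit_ball_volume_gt0.
have K00 : 0 <= K0 by rewrite !mulr_ge0 ?exprn_ge0 ?mulr_ge0 ?expR_ge0// ltW.
have K0' : 0 <= K by apply: mulr_ge0 => //; apply: mulr_ge0; rewrite ?expR_ge0.
(* The probability that coverage fails is at most [K / w n]. *)
have U : (fun n => fine (P n (~` C n))) n @[n --> \oo] --> 0.
  apply: (cvg0_le_div K0' hw); near=> n.
  have n0 : (0 < n)%N by near: n; exists 1%N.
  have mC : measurable (C n) by exact: (measurable_coverage_event (hX n0) hd).
  have nR0 : 0 < n%:R :> R by rewrite ltr0n.
  have l2 : 2 <= ln n%:R :> R by near: n; exact: near_le_ln.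
  have w1 : 1 <= w n by near: n; move/cvgryPge: hw; exact.
  have rn : r n <= 1 / 2.
    have : `|0 - r n| <= 1 / 2 by near: n; apply: hr; lra.
    by rewrite sub0r normrN gtr0_norm.
  have EL : n%:R * om * r n ^+ d = ln n%:R + m%:R * ln (ln n%:R) + w n by near: n.
  set L := _ + w n in EL.
  have ll0 : 0 <= m%:R * ln (ln n%:R) :> R by rewrite mulr_ge0// ln_ge0//; lra.
  have L2 : 2 <= L by rewrite /L; lra.
  have r01 : 0 < r n <= 1 / 2 by rewrite hr_pos.
  rewrite fine_ge0//=.
  have := prob_uncovered_le (hX n0) hd k (esym EL) nR0 r01 L2.
  rewrite -[X in (X <= _)%E](@fineK R); last first.
    by apply: fin_num_measure; exact: measurableC.
  rewrite lee_fin => /le_trans; apply; rewrite -/om -/K0.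
  rewrite (_ : K / w n = K0 * (expR m.+1%:R * m.+1`!%:R / w n)); last exact/esym/mulrA.
  apply: ler_wpM2l => //.
  have := @supercritical_le R (ln n%:R) (w n) m _ _.
  rewrite -/L lnK ?posrE// => /(_ (ltac:(lra)) (ltac:(lra))) H.
  apply: (le_trans H); rewrite ler_wpM2l ?mulr_ge0 ?expR_ge0//.
  rewrite lef_pV2 ?posrE ?lerDr//; first by rewrite ltr_pwDl// ?ltr0n//; lra.
  by lra.
have : (fun n => 1 - fine (P n (~` C n))) n @[n --> \oo] --> (1 - 0 : R).
  by apply: cvgB => //; exact: cvg_cst.
rewrite subr0; apply: cvg_trans; apply: near_eq_cvg.
near=> n => /=.
have n0 : (0 < n)%N by near: n; exists 1%N.
have mC : measurable (C n) by exact: (measurable_coverage_event (hX n0) hd).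
rewrite probability_setC// fineB//; first by rewrite opprB addrC subrK.
by apply: fin_num_measure.
Unshelve. all: by end_near.
Qed.

Lemma coverage_cvg0 :
  (\forall n \near \oo,
    n%:R * om * r n ^+ d = ln n%:R + m%:R * ln (ln n%:R) - w n) ->
  P n (C n) @[n --> \oo] --> 0%E.
Proof.
move=> hL; apply/fine_cvgP; split; first exact: near_coverage_fin_num.
pose K0 := 4 ^+ d * k.-1`!%:R * 2 ^+ k * (2 / (1 - expR (- (8 * d%:R)^-1))) ^+ d / om.
have om0 : 0 < om by exact: unit_ball_volume_gt0.
have dR0 : 0 < d%:R :> R by rewrite ltr0n.
have rho1 : expR (- (8 * d%:R)^-1) <= 1 :> R.
  by rewrite -expR0 ler_expR oppr_le0 invr_ge0 mulr_ge0.
have K00 : 0 <= K0.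
  by rewrite !mulr_ge0 ?exprn_ge0 ?divr_ge0 ?subr_ge0 ?invr_ge0 ?(ltW om0).
have K0' : 0 <= K0 * 2 ^+ m by rewrite mulr_ge0 ?exprn_ge0.
(* Coverage is monotone in the radius, so [r] may be enlarged to bring [w] below
   [ln n / 2]; this keeps [L / ln n] away from 0. *)
pose w' n := Num.min (w n) (ln n%:R / 2).
have hw' : w' n @[n --> \oo] --> +oo.
  apply/cvgryPge => A; near=> n; rewrite le_min; apply/andP; split.
    by near: n; move/cvgryPge: hw; exact.
  have : A * 2 <= ln n%:R by near: n; exact: near_le_ln.
  by lra.
apply: (cvg0_le_div K0' hw'); near=> n.
have n0 : (0 < n)%N by near: n; exists 1%N.
have mC : measurable (C n) by exact: (measurable_coverage_event (hX n0) hd).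
have nR0 : 0 < n%:R :> R by rewrite ltr0n.
rewrite /= fine_ge0//=.
have l2 : 2 <= ln n%:R :> R by near: n; exact: near_le_ln.
have lbig : 2 * (1 + m%:R) * 4 ^+ d / om <= ln n%:R by near: n; exact: near_le_ln.
have w1 : 1 <= w' n by near: n; move/cvgryPge: hw'; exact.
have w'w : w' n <= w n by rewrite /w' ge_min lexx.
have w'l : w' n <= ln n%:R / 2 by rewrite /w' ge_min lexx orbT.
have EL : n%:R * om * r n ^+ d = ln n%:R + m%:R * ln (ln n%:R) - w n by near: n.
have nl : ln n%:R * (ln n%:R / 2) <= n%:R :> R.
  by rewrite -[leRHS]lnK ?posrE//; apply: ler_ln_expR; lra.
set l := ln n%:R in l2 lbig w'l EL nl.
have l0 : 0 < l by lra.
have ll0 : 0 <= m%:R * ln l by rewrite mulr_ge0// ln_ge0//; lra.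
pose L := l + m%:R * ln l - w' n.
have L1 : 1 <= L by rewrite /L; lra.
have L0 : 0 < L by lra.
(* [r'] is the radius whose ball has mean count exactly [L], the critical value lowered by [w']
   instead of [w]. *)
pose q := L / (n%:R * om).
have q0 : 0 < q by rewrite divr_gt0// mulr_gt0.
pose r' := q `^ d%:R^-1.
have r'0 : 0 < r' by exact: powR_gt0.
have r'd : r' ^+ d = q.
  by rewrite -powR_mulrn ?powR_ge0// -powRrM mulVf ?powRr1 ?gt_eqF// ltW.
have EL' : L = n%:R * om * r' ^+ d.
  by rewrite r'd /q mulrC divfK// gt_eqF// mulr_gt0.
have Lle : L <= (1 + m%:R) * l.
  have := ln_sublinear l0; have : 0 <= m%:R :> R by [].
  by rewrite /L => m0 H; nra.
(* The mean [L] is at most [(1 + m) * l], while [n] is at least [l^2 / 2], so [q] is of order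
   [1 / l] at most; [lbig] is the threshold that brings it below [(1 / 4)^d]. *)
have r'4 : r' <= 1 / 4.
  rewrite -(@ler_pXn2r _ d)// ?nnegrE ?(ltW r'0)//.
  rewrite r'd /q ler_pdivrMr ?mulr_gt0//.
  apply: (le_trans Lle).
  apply: (@le_trans _ _ ((1 / 4) ^+ d * (l * (l / 2) * om))); last first.
    by rewrite ler_wpM2l ?exprn_ge0// ler_pM2r.
  move: lbig; rewrite ler_pdivrMr// => lbig.
  rewrite expr_div_n expr1n div1r mulrC ler_pdivlMl ?exprn_gt0//.
  rewrite (_ : l * (l / 2) * om = l * (l * om / 2)); last by ring.
  rewrite (_ : 4 ^+ d * (l * (1 + m%:R)) = l * (4 ^+ d * (1 + m%:R))); last by ring.
  by rewrite ler_pM2l//; lra.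
have rr' : r n <= r'.
  rewrite -(@ler_pXn2r _ d)// ?nnegrE ?(ltW r'0) ?(ltW (hr_pos _))//.
  rewrite -(ler_pM2l (mulr_gt0 nR0 om0)) EL -EL' /L.
  by lra.
have mC' : measurable (coverage_event k r' (@X n)).
  exact: (measurable_coverage_event (hX n0) hd).
apply: (@le_trans _ _ (fine (P n (coverage_event k r' (@X n))))).
  rewrite fine_le ?fin_num_measure//; apply: le_measure; rewrite ?inE//.
  exact: coverage_event_mono.
have r'01 : 0 < r' <= 1 / 4 by rewrite r'0.
apply: le_trans (prob_covered_le (hX n0) hd nR0 hk EL' r'01 L1) _.
rewrite -/om -/K0 (_ : K0 * _ / w' n = K0 * (2 ^+ m / w' n)); last exact/esym/mulrA.
rewrite ler_wpM2l//.
have := @subcritical_ge R l (w' n) m _ _.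
rewrite -/L lnK ?posrE// => /(_ (ltac:(lra)) (ltac:(lra))) H.
rewrite -[leRHS]invrK invf_div lef_pV2 ?posrE//.
- by rewrite !mulr_gt0 ?exprn_gt0 ?expR_gt0.
- by rewrite divr_gt0 ?exprn_gt0//; lra.
Unshelve. all: by end_near.
Qed.

End main_limits.

Theorem theorem3p1 (R : realType) (d k : nat) (hd : (1 <= d)%N) (hk : (1 <= k)%N)
    (disp : nat -> measure_display)
    (Omega : forall n : nat, measurableType (disp n))
    (P : forall n : nat, probability (Omega n) R)
    (X : forall n : nat, Omega n -> set (torus R d))
    (hX : forall n : nat, (0 < n)%N -> poisson_process (P n) n%:R (X n))
    (r : nat -> R) (hr_pos : forall n : nat, 0 < r n)
    (hr : r n @[n --> \oo] --> 0)
    (w : nat -> R) (hw : w n @[n --> \oo] --> +oo) :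
  let Lambda (n : nat) : R := n%:R * unit_ball_volume R d * r n ^+ d in
  let mu (n : nat) : R :=
    ln n%:R + (d%:R + k%:R - 2) * ln (ln n%:R) in
  ((\forall n \near \oo, Lambda n = mu n + w n) ->
     P n (coverage_event k (r n) (X n)) @[n --> \oo] --> 1%E) /\
  ((\forall n \near \oo, Lambda n = mu n - w n) ->
     P n (coverage_event k (r n) (X n)) @[n --> \oo] --> 0%E).
Proof.
(* The exponent becomes a natural number; the truncated predecessors are exact because [d] and [k]
   are positive. *)
have -> : d%:R + k%:R - 2 = (d.-1 + k.-1)%:R :> R.
  by rewrite -[in LHS](prednK hd) -[in LHS](prednK hk) natrD -!natr1; ring.
by split; [exact: coverage_cvg1|exact: coverage_cvg0].
Qed.
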